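(* For $k\in\mathbb{N}_+$, the elements $t^{k\alpha_1+(2k-1)\alpha_2}s_1s_2$ and $t^{k\alpha_1+(2k-1)\alpha_2}s_2s_1$ are strongly conjugate, and thus $T_{t^{k\alpha_1+(2k-1)\alpha_2}s_1s_2}\equiv T_{t^{k\alpha_1+(2k-1)\alpha_2}s_2s_1}\bmod[\widetilde H,\widetilde H]$. Let $\tilde w=t^{k\alpha_1+(2k-1)\alpha_2}s_1s_2$ or $\tilde w=t^{k\alpha_1+(2k-1)\alpha_2}s_2s_1$. If $k=1$, then $\tilde w$ is of minimal length in $\mathbb{O}_2$, so $f_{\tilde w,\mathbb{O}_2}=1$ and $f_{\tilde w,\mathbb{O}}=0$ for all other $\mathbb{O}$. If $k\geq2$, then $$f_{\tilde w,\mathbb{O}}=\begin{cases}(v-v^{-1})^2,&\mathbb{O}=\mathbb{O}_\lambda,\ \lambda\in Q_{(k-1)(\alpha_1+2\alpha_2)},\\ v-v^{-1},&\mathbb{O}\in\mathbb{O}^{\leqslant}_{t^{(k-1)(\alpha_1+2\alpha_2)}s_1}\cup\mathbb{O}'^{\leqslant}_{t^{(k-1)(\alpha_1+2\alpha_2)}s_2},\\ 1,&\mathbb{O}=\mathbb{O}_2,\\ 0,&\text{otherwise.}\end{cases}$$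
   Context: $W=\langle s_1,s_2\rangle$ is the finite Weyl group of type $A_2$; $\alpha_1,\alpha_2$ are the simple roots, identified with the simple coroots ($\langle\alpha_i,\alpha_i\rangle=2$, $\langle\alpha_1,\alpha_2\rangle=-1$); $Q=\mathbb{Z}\alpha_1\oplus\mathbb{Z}\alpha_2$; $P$ is the coweight lattice, $P_+$ its dominant elements; $\widetilde W=P\rtimes W$ with translations $t^\lambda$. $W_a=Q\rtimes W$ is the Coxeter group generated by $s_0=t^{\alpha_1+\alpha_2}s_1s_2s_1$, $s_1$, $s_2$; $\widetilde W=W_a\rtimes\langle\tau\rangle$ with $\tau^3=1$, $\tau s_0\tau^{-1}=s_1$, $\tau s_1\tau^{-1}=s_2$, $\tau s_2\tau^{-1}=s_0$; $\ell(w\tau^j)=\ell(w)$ for $w\in W_a$. $\mathbb{N}_+$ is the set of positive integers. Strong conjugacy: $\tilde w,\tilde w'$ are elementarily strongly conjugate if $\ell(\tilde w)=\ell(\tilde w')$ and there is $\tilde x\in\widetilde W$ with $\tilde w'=\tilde x\tilde w\tilde x^{-1}$ and $\ell(\tilde x\tilde w)=\ell(\tilde x)+\ell(\tilde w)$ or $\ell(\tilde w\tilde x^{-1})=\ell(\tilde x)+\ell(\tilde w)$; strongly conjugate means connected by a finite chain of elementarily strongly conjugate elements. Class polynomials: $\widetilde H$ is the algebra over $\mathbb{Z}[v,v^{-1}]$ with basis $T_{\tilde w}$ ($\tilde w\in\widetilde W$), $T_{\tilde x}T_{\tilde y}=T_{\tilde x\tilde y}$ if $\ell(\tilde x)+\ell(\tilde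 y)=\ell(\tilde x\tilde y)$, and $(T_s-v)(T_s+v^{-1})=0$ for $s\in\{s_0,s_1,s_2\}$. $[\widetilde H,\widetilde H]$ is the submodule spanned by commutators. For a conjugacy class $\mathbb{O}$ of $\widetilde W$, $\ell(\mathbb{O})$ is its minimal length and $T_{\mathbb{O}}$ is the image in $\widetilde H/[\widetilde H,\widetilde H]$ of $T_{w}$ for any minimal length $w\in\mathbb{O}$; by He–Nie this is well defined and the $T_{\mathbb{O}}$ form a basis. The class polynomials $f_{\tilde w,\mathbb{O}}$ are the unique coefficients with $T_{\tilde w}\equiv\sum_{\mathbb{O}}f_{\tilde w,\mathbb{O}}T_{\mathbb{O}}\bmod[\widetilde H,\widetilde H]$. Conjugacy classes of $\widetilde W$ in $W_a$: $\mathbb{O}_2=\{t^\lambda s_1s_2,\ t^\lambda s_2s_1\mid\lambda\in Q\}$; for $\lambda\in Q\cap P_+$, $\mathbb{O}_\lambda$ is the class of $t^\lambda$; for $i\in\mathbb{N}_+$, $\mathbb{C}_i=\{t^{k\alpha_1+i\alpha_2}s_1,\ t^{-i\alpha_1+k\alpha_2}s_2,\ t^{k\alpha_1+(k-i)\alpha_2}s_1s_2s_1\mid k\in\mathbb{Z}\}$, $\mathbb{C}'_i=\{t^{k\alpha_1-i\alpha_2}s_1,\ t^{i\alpha_1+k\alpha_2}s_2,\ t^{(k-i)\alpha_1+k\alpha_2}s_1s_2s_1\mid k\in\mathbb{Z}\}$. For $\lambda\in Q\cap P_+$: $\mathbb{O}^{\leqslant}_{t^\lambda s_1}$ is the set of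 all $\mathbb{C}_i$ ($i\in\mathbb{N}_+$) with $\ell(\mathbb{C}_i)\leq\ell$ of the conjugacy class of $t^\lambda s_1$; $\mathbb{O}'^{\leqslant}_{t^\lambda s_2}$ is the set of all $\mathbb{C}'_i$ with $\ell(\mathbb{C}'_i)\leq\ell$ of the conjugacy class of $t^\lambda s_2$. $Q_{sh}=Q\setminus\{k(\alpha_1+2\alpha_2),k(2\alpha_1+\alpha_2),k(\alpha_1-\alpha_2)\mid k\in\mathbb{Z}\}$; for $\alpha\in Q$, $Q_\alpha=\{\lambda\in Q\cap P_+\mid\lambda<\alpha\}\cap Q_{sh}$, where $\lambda<\alpha$ means $\alpha-\lambda$ is a nonzero combination of $\alpha_1,\alpha_2$ with nonnegative integer coefficients. *)

(* Defs.v *)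
From HB Require Import structures.
From mathcomp Require Import all_boot all_order all_algebra all_fingroup zify.
From mathcomp Require Import mathcomp_extra boolp classical_sets functions
  cardinality fsbigop.
From Stdlib Require Import Relations.

Set Implicit Arguments.
Unset Strict Implicit.
Unset Printing Implicit Defensive.

Import GRing.Theory.

Local Open Scope classical_set_scope.
Local Open Scope ring_scope.

Local Notation "x %:F" := (FracField.tofrac x).

Definition is_laurent : {pred {fraction {poly int}}} :=
  fun x => `[< exists (p : {poly int}) (n : nat), x = p%:F / 'X%:F ^+ n >].

Lemma is_laurentP (x : {fraction {poly int}}) :
  reflect (exists (p : {poly int}) (n : nat), x = p%:F / 'X%:F ^+ n)
          (x \in is_laurent).
Proof. exact: asboolP. Qed.

Lemma tofracX_neq0 : ('X : {poly int})%:F != 0.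
Proof. by rewrite tofrac_eq0 polyX_eq0. Qed.

Lemma is_laurent_subring : subring_closed is_laurent.
Proof.
have X0 n : ('X : {poly int})%:F ^+ n != 0 by rewrite expf_neq0 ?tofracX_neq0.
split.
- by apply/is_laurentP; exists 1, 0; rewrite tofrac1 expr0 divr1.
- move=> _ _ /is_laurentP[p [m ->]] /is_laurentP[q [n ->]].
  apply/is_laurentP; exists (p * 'X^n - q * 'X^m), (m + n)%N.
  rewrite -mulNr addf_div // mulNr exprD tofracB !tofracM !tofracXn.
  by [].
- move=> _ _ /is_laurentP[p [m ->]] /is_laurentP[q [n ->]].
  apply/is_laurentP; exists (p * q), (m + n)%N.
  by rewrite mulf_div exprD tofracM.
Qed.

HB.instance Definition _ :=
  GRing.isSubringClosed.Build _ is_laurent is_laurent_subring.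

(* Z[v, v^-1], as a subring of the fraction field of Z[v] *)
Record laurent := Laurent {
  laurent_val :> {fraction {poly int}};
  _ : laurent_val \in is_laurent }.

HB.instance Definition _ := [isSub for laurent_val].
HB.instance Definition _ := [Choice of laurent by <:].
HB.instance Definition _ := [SubChoice_isSubComNzRing of laurent by <:].

Lemma vgen_subproof : ('X : {poly int})%:F \in is_laurent.
Proof. by apply/is_laurentP; exists 'X, 0; rewrite expr0 divr1. Qed.

Lemma vinv_subproof : (('X : {poly int})%:F)^-1 \in is_laurent.
Proof. by apply/is_laurentP; exists 1, 1; rewrite tofrac1 expr1 div1r. Qed.

Definition vgen : laurent := Laurent vgen_subproof.
Definition vinv : laurent := Laurent vinv_subproof.

Lemma vgenK : vgen * vinv = 1.
Proof. by apply: val_inj; rewrite /= divff ?tofracX_neq0. Qed.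

(* (a, b) stands for a omega_1 + b omega_2, where omega_1, omega_2 is the basis
   dual to alpha_1, alpha_2: the coordinates of x are <x, alpha_1> and
   <x, alpha_2>. *)
Definition coweight := (int * int)%type.
HB.instance Definition _ := GRing.Zmodule.on coweight.

Definition alpha1 : coweight := (2, -1).
Definition alpha2 : coweight := (-1, 2).

Definition root_comb (a b : int) : coweight := alpha1 *~ a + alpha2 *~ b.

Definition root_lattice : set coweight :=
  [set l | exists a b : int, l = root_comb a b].

Definition dominant : set coweight := [set l | (0 <= l.1) && (0 <= l.2)].

(* [root_lt l a] is l < a in the root order. *)
Definition root_lt (l a : coweight) : Prop :=
  exists m n : nat, (m, n) <> (0, 0)%N /\ a - l = root_comb m%:Z n%:Z.

Definition Q_sh : set coweight :=
  root_lattice `\` [set l | exists k : int,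
    l = root_comb k (2 * k) \/ l = root_comb (2 * k) k \/ l = root_comb k (- k)].

Definition Q_below (a : coweight) : set coweight :=
  [set l | root_lattice l /\ dominant l /\ root_lt l a] `&` Q_sh.

(* W = 'S_3 permutes the coordinates of Z^3, and a coweight (a, b) is the class
   of (a + b, b, 0) in Z^3 / Z (1, 1, 1).  Since mathcomp composes permutations
   from left to right, (w x)_i = x_(w i) is a left action. *)
Definition o0 : 'I_3 := @Ordinal 3 0 isT.
Definition o1 : 'I_3 := @Ordinal 3 1 isT.
Definition o2 : 'I_3 := @Ordinal 3 2 isT.

Definition lift3 (l : coweight) (i : 'I_3) : int :=
  match val i with 0 => l.1 + l.2 | 1 => l.2 | _ => 0 end.

Definition Wact (w : 'S_3) (l : coweight) : coweight :=
  (lift3 l (w o0) - lift3 l (w o1), lift3 l (w o1) - lift3 l (w o2)).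

Lemma ord3P (P : 'I_3 -> Prop) : P o0 -> P o1 -> P o2 -> forall i, P i.
Proof.
move=> P0 P1 P2 [[|[|[|//]]] ltm].
- by rewrite (_ : Ordinal _ = o0) //; apply: val_inj.
- by rewrite (_ : Ordinal _ = o1) //; apply: val_inj.
- by rewrite (_ : Ordinal _ = o2) //; apply: val_inj.
Qed.

Lemma lift3_act w l i : lift3 (Wact w l) i = lift3 l (w i) - lift3 l (w o2).
Proof. by elim/ord3P: i; rewrite /lift3 /= ?addrA ?subrK ?subrr. Qed.

Lemma WactM (w u : 'S_3) l : Wact (w * u)%g l = Wact w (Wact u l).
Proof.
by rewrite [RHS]/Wact !lift3_act /Wact !permM !opprB !addrA !subrK.
Qed.

Lemma Wact1 l : Wact 1%g l = l.
Proof. by case: l => a b; rewrite /Wact !perm1 /lift3 /= addrK subr0. Qed.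

Lemma WactD w l m : Wact w (l + m) = Wact w l + Wact w m.
Proof.
have liftD i : lift3 (l + m) i = lift3 l i + lift3 m i.
  by elim/ord3P: i; rewrite /lift3 /= ?addr0 // addrACA.
by rewrite /Wact !liftD !opprD; congr pair; rewrite /= addrACA.
Qed.

(* (l, w) stands for t^l w. *)
Definition extW := (coweight * 'S_3)%type.
HB.instance Definition _ := Choice.on extW.

Definition extW_one : extW := (0, 1%g).
Definition extW_mul (x y : extW) : extW :=
  (x.1 + Wact x.2 y.1, (x.2 * y.2)%g).
Definition extW_inv (x : extW) : extW :=
  (- Wact x.2^-1%g x.1, x.2^-1%g).

Lemma Wact0 w : Wact w 0 = 0.
Proof. by apply: (addrI (Wact w 0)); rewrite -WactD !addr0. Qed.

Lemma WactN w l : Wact w (- l) = - Wact w l.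
Proof. by apply: (addrI (Wact w l)); rewrite -WactD !subrr Wact0. Qed.

Lemma extW_mulA : associative extW_mul.
Proof.
by move=> x y z; rewrite /extW_mul /= WactD WactM addrA mulgA.
Qed.

Lemma extW_mul1x : left_id extW_one extW_mul.
Proof. by case=> l w; rewrite /extW_mul /= Wact1 add0r mul1g. Qed.

Lemma extW_mulx1 : right_id extW_one extW_mul.
Proof. by case=> l w; rewrite /extW_mul /= Wact0 addr0 mulg1. Qed.

Lemma extW_mulVx : left_inverse extW_one extW_inv extW_mul.
Proof. by case=> l w; rewrite /extW_mul /= addNr mulVg. Qed.

Lemma extW_mulxV : right_inverse extW_one extW_inv extW_mul.
Proof.
by case=> l w; rewrite /extW_mul /= WactN -WactM mulgV Wact1 subrr.
Qed.

HB.instance Definition _ := isGroup.Build extW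
  extW_mulA extW_mul1x extW_mulx1 extW_mulVx extW_mulxV.

Definition transl (l : coweight) : extW := (l, 1%g).

Definition s1 : extW := (0, tperm o0 o1).
Definition s2 : extW := (0, tperm o1 o2).
Definition s0 : extW := (transl (alpha1 + alpha2) * s1 * s2 * s1)%g.
Definition omega1 : coweight := (1, 0).
Definition tau : extW := (transl omega1 * s1 * s2)%g.

Lemma root_combE a b : root_comb a b = (2 * a - b, 2 * b - a).
Proof.
have mulnE (x y : int) n : ((x, y) : coweight) *+ n = (x *+ n, y *+ n).
  by elim: n => [|n IH] //; rewrite !mulrS IH.
have mulzE (x y n : int) : ((x, y) : coweight) *~ n = (x * n, y * n).
  by rewrite -2!mulrzz; case: n => n; rewrite /intmul ?NegzE mulnE //.
rewrite /root_comb !mulzE; congr pair => /=; lia.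
Qed.

Lemma Wact_s1 l : Wact s1.2 l = l - root_comb l.1 0.
Proof.
case: l => a b; rewrite root_combE /Wact tpermL tpermR tpermD // /lift3 /=.
by congr pair => /=; lia.
Qed.

Lemma Wact_s2 l : Wact s2.2 l = l - root_comb 0 l.2.
Proof.
case: l => a b; rewrite root_combE /Wact tpermL tpermR tpermD // /lift3 /=.
by congr pair => /=; lia.
Qed.

Lemma extW_eq (x y : extW) :
  x.1 = y.1 -> x.2 o0 = y.2 o0 -> x.2 o1 = y.2 o1 -> x.2 o2 = y.2 o2 -> x = y.
Proof.
case: x y => [l w] [m u] /= -> e0 e1 e2; congr pair.
by apply/permP; apply: ord3P.
Qed.

Lemma s1E : (s1.2 o0 = o1) * (s1.2 o1 = o0) * (s1.2 o2 = o2).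
Proof. by rewrite /= tpermL tpermR tpermD. Qed.

Lemma s2E : (s2.2 o0 = o0) * (s2.2 o1 = o2) * (s2.2 o2 = o1).
Proof. by rewrite /= tpermL tpermR tpermD. Qed.

Lemma extWM1 (x y : extW) : (x * y)%g.1 = x.1 + Wact x.2 y.1.
Proof. by []. Qed.

Lemma extWM2 (x y : extW) i : (x * y)%g.2 i = y.2 (x.2 i).
Proof. exact: permM. Qed.

Ltac extW_compute :=
  apply: extW_eq;
  rewrite /tau /s0 ?extWM1 /Wact ?extWM2 ?(s1E, s2E, perm1, extWM2) //.

Lemma tau3 : (tau ^+ 3 = 1)%g.
Proof. by rewrite !expgS expg0 mulg1; extW_compute. Qed.

Lemma tau_s0 : (tau * s0 * tau^-1 = s1)%g.
Proof. by apply: (mulIg tau); rewrite mulgKV; extW_compute. Qed.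

Lemma tau_s1 : (tau * s1 * tau^-1 = s2)%g.
Proof. by apply: (mulIg tau); rewrite mulgKV; extW_compute. Qed.

Lemma tau_s2 : (tau * s2 * tau^-1 = s0)%g.
Proof. by apply: (mulIg tau); rewrite mulgKV; extW_compute. Qed.

Definition set_min (A : set nat) : nat :=
  xget 0 [set n | A n /\ forall m, A m -> (n <= m)%N].

(* l(w tau^j) is the Coxeter length of w in W_a = <s0, s1, s2>, that is the
   length of a shortest word in s0, s1, s2 whose product is w. *)
Definition length (w : extW) : nat :=
  set_min [set n | exists (u : seq extW) (j : nat),
    [/\ all [in [:: s0; s1; s2]] u, size u = n &
        w = (\prod_(x <- u) x * tau ^+ j)%g]].

Definition elem_strong_conj (w w' : extW) : Prop :=
  length w = length w' /\
  exists x : extW, w' = (x * w * x^-1)%g /\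
    (length (x * w)%g = (length x + length w)%N \/
     length (w * x^-1)%g = (length x + length w)%N).

Definition strong_conj : extW -> extW -> Prop :=
  clos_refl_trans extW elem_strong_conj.

Definition conj_class (w : extW) : set extW :=
  [set (x * w * x^-1)%g | x in [set: extW]].

Definition conj_classes : set (set extW) := range conj_class.

Definition min_length_in (O : set extW) : set extW :=
  [set w | O w /\ forall x, O x -> (length w <= length x)%N].

Definition class_length (O : set extW) : nat := set_min (length @` O).

Definition O_2 : set extW :=
  [set w | exists2 l, root_lattice l &
    w = (transl l * s1 * s2)%g \/ w = (transl l * s2 * s1)%g].

Definition O_transl (l : coweight) : set extW := conj_class (transl l).

Definition C_ (i : nat) : set extW :=
  [set w | exists k : int,
    [\/ w = (transl (root_comb k i%:Z) * s1)%g,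
        w = (transl (root_comb (- i%:Z) k) * s2)%g |
        w = (transl (root_comb k (k - i%:Z)) * s1 * s2 * s1)%g]].

Definition C'_ (i : nat) : set extW :=
  [set w | exists k : int,
    [\/ w = (transl (root_comb k (- i%:Z)) * s1)%g,
        w = (transl (root_comb i%:Z k) * s2)%g |
        w = (transl (root_comb (k - i%:Z) k) * s1 * s2 * s1)%g]].

Definition C_le (l : coweight) : set (set extW) :=
  [set C_ i | i in [set i | (0 < i)%N /\
    (class_length (C_ i) <= class_length (conj_class (transl l * s1)%g))%N]].

Definition C'_le (l : coweight) : set (set extW) :=
  [set C'_ i | i in [set i | (0 < i)%N /\
    (class_length (C'_ i) <= class_length (conj_class (transl l * s2)%g))%N]].

(* [Hecke_basis T]: the algebra H, with basis T, is the Iwahori-Hecke algebra;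
   these conditions determine (H, T) up to a unique isomorphism. *)
Record Hecke_basis (H : algType laurent) (T : extW -> H) : Prop := {
  Hecke_basisP : forall h : H, exists! c : extW -> laurent,
    finite_set [set w | c w != 0] /\ h = \sum_(w \in [set: extW]) c w *: T w;
  Hecke_mul : forall x y : extW,
    (length x + length y)%N = length (x * y)%g -> T x * T y = T (x * y)%g;
  Hecke_quad : forall s : extW, s \in [:: s0; s1; s2] ->
    (T s - vgen%:A) * (T s + vinv%:A) = 0 }.

Definition commutators (H : algType laurent) : set H :=
  [set h | exists r : seq (laurent * (H * H)),
    h = \sum_(p <- r) p.1 *: (p.2.1 * p.2.2 - p.2.2 * p.2.1)].

Definition comm_equiv (H : algType laurent) (h h' : H) : Prop :=
  commutators (h - h').

(* f is a family of coefficients of T_w on the T_O.  It only matters on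
   conj_classes; it is set to 0 elsewhere to make it unique.  The T_O are
   represented by T (m O) for any choice of minimal length elements m O. *)
Definition class_coefs (H : algType laurent) (T : extW -> H) (w : extW) :
    set (set extW -> laurent) :=
  [set f | [/\ forall O, ~ conj_classes O -> f O = 0,
    finite_set [set O | f O != 0] &
    forall m : set extW -> extW,
      (forall O, conj_classes O -> min_length_in O (m O)) ->
      comm_equiv (T w) (\sum_(O \in conj_classes) f O *: T (m O))]].

Definition class_poly (H : algType laurent) (T : extW -> H) (w : extW) :
    set extW -> laurent :=
  xget (fun=> 0) (class_coefs T w).

(* Main.v *)
(* Modulo commutators, T_(s w s) = T_w if l(s w s) = l(w), and
   T_w = T_(s w s) + (v - v^-1) T_(s w) if l(s w s) = l(w) - 2.  Put n = k - 1 and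
   let w_k be the element of the theorem.  Three length-decreasing conjugations
   lead from w_k to w_(k-1); they split off minimal length elements of C_(2n) and
   C_(2n-1), and the element t^(n alpha1 - n alpha2) s1 of C'_n.  The latter
   reduces to a minimal length element of C'_n, splitting off one translation
   t^(n alpha1 + j alpha2) for each j with n/2 < j < 2n.  Summing over k gives
   the expansion of T_(w_k).

   This expansion gives the class polynomials because the T_O are linearly
   independent in the cocenter.  To see it, evaluate a relation on the traces of
   three families of representations: the principal series, the representations
   induced from the trivial one of a Levi subalgebra of type A1, and the index
   representation twisted by Z/3.  At v = 1 these traces become characters of
   P x| W that separate the conjugacy classes, so all the coefficients of the
   relation vanish at v = 1; dividing by v - 1 one lowers the degrees of the
   coefficients, and concludes by induction. *)
From HB Require Import structures.
Require Import Defs.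
From mathcomp Require Import all_boot all_order all_algebra all_fingroup.
From mathcomp Require Import mathcomp_extra boolp classical_sets functions
  cardinality fsbigop.
From mathcomp Require Import zify ring.
Import GRing.Theory.
Local Open Scope classical_set_scope.
Local Open Scope ring_scope.

Set Implicit Arguments.
Unset Strict Implicit.
Unset Printing Implicit Defensive.

(** * Coordinates and length *)

(** For the characters at v = 1 to separate infinitely many classes, the parameters of the
    representations must be generic. The traces therefore take values in Q(z)[v] with a second
    indeterminate z, and the integer coefficients are read off from the powers of z. The separation
    is triangular. At v = 1 the principal series vanishes on all classes other than those of
    translations; once the translations are gone, the representation induced from type A1 tells the
    elements t^(n omega1) s1 apart by the exponent of z; a trace twisted by powers of the image of
    tau handles the three classes that remain. Division by v - 1 takes place among polynomials, so v
    T_s is represented instead of T_s, and the relation is multiplied by a power of v. Class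
    polynomials refer to every choice of minimal length representatives. That T_w modulo commutators
    is the same for all of them is checked by hand for the classes that occur in the expansion.
    Group computations are done in coordinates, where the length is a sum of three absolute values
    and [lia] decides. *)

Local Notation simples := [:: s0; s1; s2].

(* The six elements of W as reduced words: a stands for s1 and b for s2. *)
Inductive wt := We | Wa | Wb | Wab | Wba | Waba.

Definition perm_of (t : wt) : 'S_3 :=
  match t with
  | We => 1 | Wa => s1.2 | Wb => s2.2 | Wab => s1.2 * s2.2
  | Wba => s2.2 * s1.2 | Waba => s1.2 * s2.2 * s1.2
  end%g.

Definition mk (a b : int) (t : wt) : extW := ((a, b), perm_of t).

Definition wt_act (t : wt) (a b : int) : int * int :=
  match t with
  | We => (a, b) | Wa => (- a, a + b) | Wb => (a + b, - b)
  | Wab => (- a - b, a) | Wba => (b, - a - b) | Waba => (- b, - a)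
  end.

Definition wt_mul (t u : wt) : wt :=
  match t, u with
  | We, u => u
  | Wa, We => Wa | Wa, Wa => We | Wa, Wb => Wab | Wa, Wab => Wb
  | Wa, Wba => Waba | Wa, Waba => Wba
  | Wb, We => Wb | Wb, Wa => Wba | Wb, Wb => We | Wb, Wab => Waba
  | Wb, Wba => Wa | Wb, Waba => Wab
  | Wab, We => Wab | Wab, Wa => Waba | Wab, Wb => Wa | Wab, Wab => Wba
  | Wab, Wba => We | Wab, Waba => Wb
  | Wba, We => Wba | Wba, Wa => Wb | Wba, Wb => Waba | Wba, Wab => We
  | Wba, Wba => Wab | Wba, Waba => Wa
  | Waba, We => Waba | Waba, Wa => Wab | Waba, Wb => Wba | Waba, Wab => Wa
  | Waba, Wba => Wb | Waba, Waba => We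
  end.

Definition perm_val (t : wt) : 'I_3 * 'I_3 * 'I_3 :=
  match t with
  | We => (o0, o1, o2) | Wa => (o1, o0, o2) | Wb => (o0, o2, o1)
  | Wab => (o2, o0, o1) | Wba => (o1, o2, o0) | Waba => (o2, o1, o0)
  end.

Lemma perm_ofE t : (perm_of t o0, perm_of t o1, perm_of t o2) = perm_val t.
Proof. by case: t; rewrite /perm_of ?permM ?perm1 ?(s1E, s2E). Qed.

Lemma perm_ofE3 t : (perm_of t o0 = (perm_val t).1.1)
  * (perm_of t o1 = (perm_val t).1.2) * (perm_of t o2 = (perm_val t).2).
Proof. by rewrite -perm_ofE. Qed.

Lemma perm_eqP (p q : 'S_3) :
  (p o0, p o1, p o2) = (q o0, q o1, q o2) -> p = q.
Proof. by case=> e0 e1 e2; apply/permP; apply: ord3P. Qed.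

Lemma perm_of_inj : injective perm_of.
Proof.
move=> t u e; have := perm_ofE t; rewrite e perm_ofE.
by case: t {e}; case: u.
Qed.

Lemma perm_of_mul t u : (perm_of t * perm_of u)%g = perm_of (wt_mul t u).
Proof.
apply: perm_eqP; rewrite perm_ofE !permM !perm_ofE3.
by case: t => /=; rewrite !perm_ofE3; case: u.
Qed.

Lemma perm_of_surj p : exists t, p = perm_of t.
Proof.
suff [t Ht] : exists t, (p o0, p o1, p o2) = perm_val t.
  by exists t; apply: perm_eqP; rewrite Ht perm_ofE.
have n01 : p o0 != p o1 by rewrite (inj_eq perm_inj).
have n02 : p o0 != p o2 by rewrite (inj_eq perm_inj).
have n12 : p o1 != p o2 by rewrite (inj_eq perm_inj).
move: (p o0) (p o1) (p o2) n01 n02 n12 => x y z.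
by elim/ord3P: x; elim/ord3P: y; elim/ord3P: z => // _ _ _;
  [exists We | exists Wb | exists Wa | exists Wba | exists Wab | exists Waba].
Qed.

Lemma mk_surj x : exists a b t, x = mk a b t.
Proof.
by case: x => [[a b] p]; have [t ->] := perm_of_surj p; exists a, b, t.
Qed.

Lemma mk_inj a b t c d u : mk a b t = mk c d u -> [/\ a = c, b = d & t = u].
Proof. by case=> -> -> /perm_of_inj ->. Qed.

Lemma Wact_mk t a b : Wact (perm_of t) (a, b) = wt_act t a b.
Proof.
rewrite /Wact !perm_ofE3.
by case: t; rewrite /lift3 /=; congr pair; lia.
Qed.

Lemma mkM a b t c d u : (mk a b t * mk c d u)%g =
  mk (a + (wt_act t c d).1) (b + (wt_act t c d).2) (wt_mul t u).
Proof.
rewrite /mk -perm_of_mul.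
by rewrite {1}/mulg /= /extW_mul /= Wact_mk; case: (wt_act _ _ _).
Qed.

Lemma one_mk : (1%g : extW) = mk 0 0 We. Proof. by []. Qed.
Lemma s1_mk : s1 = mk 0 0 Wa. Proof. by []. Qed.
Lemma s2_mk : s2 = mk 0 0 Wb. Proof. by []. Qed.
Lemma transl_mk a b : transl (a, b) = mk a b We. Proof. by []. Qed.

Lemma s0_mk : s0 = mk 1 1 Waba.
Proof.
rewrite /s0 s1_mk s2_mk (_ : alpha1 + alpha2 = (1, 1)) // transl_mk !mkM /=.
by [].
Qed.

Lemma tau_mk : tau = mk 1 0 Wab.
Proof. by rewrite /tau s1_mk s2_mk /omega1 transl_mk !mkM. Qed.

Definition wt_inv (t : wt) : wt :=
  match t with Wab => Wba | Wba => Wab | t => t end.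

Lemma mk_inv a b t : (mk a b t)^-1%g =
  mk (- (wt_act (wt_inv t) a b).1) (- (wt_act (wt_inv t) a b).2) (wt_inv t).
Proof.
apply: (mulgI (mk a b t)); rewrite mulgV one_mk.
by case: t; rewrite mkM /=; congr mk; lia.
Qed.

Lemma simpleV s : s \in simples -> s^-1%g = s.
Proof.
by rewrite !inE => /or3P[]/eqP->; rewrite ?s0_mk ?s1_mk ?s2_mk mk_inv.
Qed.

Lemma simple_sq s : s \in simples -> (s * s = 1)%g.
Proof. by move=> /simpleV {1}<-; rewrite mulVg. Qed.

(** The entries are [w^-1 r < 0] for r = alpha1, alpha2, alpha1 + alpha2, in this order. *)
Definition inv_ind (t : wt) : int * int * int :=
  match t with
  | We => (0, 0, 0) | Wa => (1, 0, 0) | Wb => (0, 1, 0)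
  | Wab => (1, 0, 1) | Wba => (0, 1, 1) | Waba => (1, 1, 1)
  end.

(* The Iwahori-Matsumoto formula: t^l w has length the sum over the positive
   roots r of |<l, r> - [w^-1 r < 0]|. *)
Definition ellz (a b : int) (t : wt) : nat :=
  let: (i, j, k) := inv_ind t in
  (absz (a - i)%R + absz (b - j)%R + absz (a + b - k)%R)%N.

Definition wt_of (p : 'S_3) : wt :=
  match val (p o0), val (p o1) with
  | 0, 1 => We | 1, 0 => Wa | 0, _ => Wb | 2, 0 => Wab | 1, _ => Wba
  | _, _ => Waba
  end%N.

Lemma perm_ofK : cancel perm_of wt_of.
Proof. by move=> t; rewrite /wt_of !perm_ofE3; case: t. Qed.

Definition ell (x : extW) : nat := ellz x.1.1 x.1.2 (wt_of x.2).

Lemma ell_mk a b t : ell (mk a b t) = ellz a b t.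
Proof. by rewrite /ell perm_ofK. Qed.

Ltac to_mk := rewrite ?s0_mk ?s1_mk ?s2_mk ?tau_mk ?mkM ?ell_mk /ellz /=.

Lemma ell_simpleM s x : s \in simples ->
  ell (s * x)%g = (ell x).+1 \/ ell x = (ell (s * x)%g).+1.
Proof.
have [a [b [t ->]]] := mk_surj x.
by rewrite !inE => /or3P[]/eqP->; to_mk; case: t => /=; lia.
Qed.

Lemma ell_tauM x : ell (tau * x)%g = ell x.
Proof. by have [a [b [t ->]]] := mk_surj x; to_mk; case: t => /=; lia. Qed.

Lemma ell_Mtau x : ell (x * tau)%g = ell x.
Proof. by have [a [b [t ->]]] := mk_surj x; to_mk; case: t => /=; lia. Qed.

Lemma ell_inv x : ell x^-1%g = ell x.
Proof.
have [a [b [t ->]]] := mk_surj x; rewrite mk_inv.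
by case: t; to_mk; lia.
Qed.

Lemma ell_gt0_descent x : (0 < ell x)%N ->
  exists2 s, s \in simples & ell x = (ell (s * x)%g).+1.
Proof.
move=> x_gt0.
suff [e|[e|e]] : ell x = (ell (s0 * x)%g).+1 \/ ell x = (ell (s1 * x)%g).+1
    \/ ell x = (ell (s2 * x)%g).+1.
- by exists s0; rewrite ?inE ?eqxx.
- by exists s1; rewrite ?inE ?eqxx ?orbT.
- by exists s2; rewrite ?inE ?eqxx ?orbT.
have [a [b [t e]]] := mk_surj x; move: x_gt0; rewrite e.
by to_mk; case: t {e} => /=; lia.
Qed.

Lemma ell_eq0 x : ell x = 0%N -> [\/ x = 1%g, x = tau | x = (tau * tau)%g].
Proof.
have [a [b [t ->]]] := mk_surj x; rewrite tau_mk one_mk mkM /= ell_mk /ellz.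
case: t => //=; try lia; move=> h.
- by apply: Or31; congr mk; lia.
- by apply: Or32; congr mk; lia.
- by apply: Or33; congr mk; lia.
Qed.

Lemma set_minP (A : set nat) n :
  A n -> (forall m, A m -> (n <= m)%N) -> set_min A = n.
Proof.
move=> An nP; rewrite /set_min; apply: xget_unique.
  by split.
by move=> m [Am mP]; apply/eqP; rewrite eqn_leq mP ?nP.
Qed.

Lemma ell_tauX j : ell (tau ^+ j)%g = 0%N.
Proof.
elim: j => [|j IH]; first by rewrite expg0 one_mk ell_mk.
by rewrite expgS ell_tauM.
Qed.

Lemma ell_word u j : all [in simples] u ->
  (ell (\prod_(x <- u) x * tau ^+ j)%g <= size u)%N.
Proof.
elim: u => [|s u IH] /=; first by rewrite big_nil mul1g ell_tauX.
case/andP=> hs /IH {IH}; rewrite big_cons -mulgA.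
move: (\prod_(x <- u) x * tau ^+ j)%g => y hy.
case: (ell_simpleM y hs) => e; first by rewrite e ltnS.
by apply: leqW; apply: ltnW; rewrite -e.
Qed.

Lemma reduced_word x : exists (u : seq extW) (j : nat),
  [/\ all [in simples] u, size u = ell x &
      x = (\prod_(y <- u) y * tau ^+ j)%g].
Proof.
move: {2}(ell x) (erefl (ell x)) => n; elim: n x => [|n IH] x ex.
  exists [::]; have [->|->|->] := ell_eq0 ex.
  - by exists 0%N; rewrite big_nil mul1g expg0 one_mk ell_mk.
  - by exists 1%N; rewrite big_nil mul1g expg1 tau_mk ell_mk.
  - by exists 2%N; rewrite big_nil mul1g expgS expg1 ell_tauM tau_mk ell_mk.
have [s hs es] : exists2 s, s \in simples & ell x = (ell (s * x)%g).+1.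
  by apply: ell_gt0_descent; rewrite ex.
have [u [j [hu su eu]]] := IH (s * x)%g (eq_add_S _ _ (etrans (esym es) ex)).
exists (s :: u), j; split; rewrite /= ?hs ?su //.
by rewrite big_cons -mulgA -eu mulgA simple_sq ?mul1g.
Qed.

(** A letter changes [ell] by one, so no word is shorter than [ell x]; conversely, descents can be
    stripped off until [ell] is 0, where only powers of tau remain. *)
Lemma lengthE x : length x = ell x.
Proof.
apply: set_minP => [|m [u [j [hu <- ->]]]]; last exact: ell_word.
exact: reduced_word.
Qed.

Lemma ell_Msimple s x : s \in simples ->
  ell (x * s)%g = (ell x).+1 \/ ell x = (ell (x * s)%g).+1.
Proof.
move=> hs; rewrite -(ell_inv (x * s)%g) -(ell_inv x) invMg (simpleV hs).
exact: ell_simpleM.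
Qed.

Lemma ell_simple s : s \in simples -> ell s = 1%N.
Proof. by rewrite !inE => /or3P[]/eqP->; to_mk. Qed.

(** Simple reflections enter only where they raise the length, since there
    [T s * T x = T (s * x)]. *)
Lemma extW_ind (P : extW -> Prop) : P 1%g ->
  (forall x, P x -> P (tau * x)%g) ->
  (forall s x, s \in simples -> ell (s * x)%g = (ell x).+1 ->
    P x -> P (s * x)%g) -> forall x, P x.
Proof.
move=> P1 Pt Ps x; move: {2}(ell x) (erefl (ell x)) => n.
elim: n x => [|n IH] x ex.
  have Ptau := Pt _ P1; rewrite mulg1 in Ptau.
  by have [->|->|->] := ell_eq0 ex; last exact: Pt.
have [s hs es] : exists2 s, s \in simples & ell x = (ell (s * x)%g).+1.
  by apply: ell_gt0_descent; rewrite ex.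
rewrite -(mul1g x) -(simple_sq hs) -mulgA; apply: Ps => //.
  by rewrite mulgA simple_sq // mul1g.
by apply: IH; apply: succn_inj; rewrite -es.
Qed.

(** * The Hecke algebra modulo commutators *)

Lemma fsum_seq (I : choiceType) (V : nmodType) (A : set I) (r : seq I)
    (f : I -> V) : uniq r -> (forall i, i \in r -> A i) ->
  (forall i, A i -> i \notin r -> f i = 0) ->
  \sum_(i \in A) f i = \sum_(i <- r) f i.
Proof.
move=> ur rA f0; rewrite (@fsbigE _ _ _ _ A r) //.
rewrite big_mkcond big_seq [RHS]big_seq; apply: eq_bigr => i ir.
by rewrite mem_set //; apply: rA.
Qed.

Definition xi : laurent := vgen - vinv.

Section Hecke.
Variables (H : algType laurent) (T : extW -> H) (HT : Hecke_basis T).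
Implicit Types (h : H) (w : extW).

Definition coord (h : H) : extW -> laurent := projT1 (cid (Hecke_basisP HT h)).

Lemma coord_finite h : finite_set [set w | coord h w != 0].
Proof. by rewrite /coord; case: cid => c [[]]. Qed.

Lemma coord_sum h : h = \sum_(w \in [set: extW]) coord h w *: T w.
Proof. by rewrite /coord; case: cid => c [[]]. Qed.

Lemma coord_uniq h c : finite_set [set w | c w != 0] ->
  h = \sum_(w \in [set: extW]) c w *: T w -> coord h = c.
Proof. by move=> fc hc; rewrite /coord; case: cid => d [? dP]; apply: dP. Qed.

Lemma suppP h : exists2 r : seq extW, uniq r &
  forall w, (w \in r) = (coord h w != 0).
Proof.
have [r e] := (finite_seqP _).1 (coord_finite h).
exists (undup r); first exact: undup_uniq.
move=> w; rewrite mem_undup; apply/idP/idP => hw.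
- by change ([set u | coord h u != 0] w); rewrite e.
- by change ([set` r] w); rewrite -e.
Qed.

Lemma coord_seq h r : uniq r -> (forall w, coord h w != 0 -> w \in r) ->
  h = \sum_(w <- r) coord h w *: T w.
Proof.
move=> ur sr; rewrite {1}(coord_sum h); apply: fsum_seq => // w _.
by apply: contraNeq => hw; apply: sr; apply: contraNneq hw => ->; rewrite scale0r.
Qed.

Lemma coord_seqP h r c : uniq r -> h = \sum_(w <- r) c w *: T w ->
  (forall w, w \notin r -> c w = 0) -> coord h = c.
Proof.
move=> ur hc c0; apply: coord_uniq.
  apply: (@sub_finite_set _ _ [set` r]); last exact: finite_seq.
  by move=> w /=; apply: contraNT => /c0->.
rewrite hc; apply/esym; apply: fsum_seq => // w _ /c0->.
by rewrite scale0r.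
Qed.

Lemma coordD a h h' : coord (a *: h + h') = fun w => a * coord h w + coord h' w.
Proof.
have [r1 _ m1] := suppP h; have [r2 _ m2] := suppP h'.
set r := undup (r1 ++ r2).
have ur : uniq r by apply: undup_uniq.
have r1r w : coord h w != 0 -> w \in r.
  by rewrite -m1 /r mem_undup mem_cat => ->.
have r2r w : coord h' w != 0 -> w \in r.
  by rewrite -m2 /r mem_undup mem_cat orbC => ->.
apply: (coord_seqP ur) => [|w wr]; last first.
  have -> : coord h w = 0 by apply/eqP; apply: contraNT wr; apply: r1r.
  have -> : coord h' w = 0 by apply/eqP; apply: contraNT wr; apply: r2r.
  by rewrite mulr0 addr0.
rewrite {1}(coord_seq ur r1r) {1}(coord_seq ur r2r) scaler_sumr -big_split /=.
by apply: eq_bigr => w _; rewrite scalerDl scalerA.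
Qed.

Lemma coordT w : coord (T w) = fun u => (u == w)%:R.
Proof.
apply: (@coord_seqP _ [:: w]) => //.
  by rewrite big_seq1 eqxx scale1r.
by move=> u; rewrite inE => /negbTE->.
Qed.

Lemma Hecke_ind (P : H -> Prop) : P 0 ->
  (forall a w h, P h -> P (a *: T w + h)) -> forall h, P h.
Proof.
move=> P0 PD h; have [r ur mr] := suppP h.
have /(coord_seq ur) -> : forall w, coord h w != 0 -> w \in r.
  by move=> w; rewrite mr.
elim: r {ur mr} => [|w r IH]; first by rewrite big_nil.
by rewrite big_cons; apply: PD.
Qed.

(** Lengths add in 1 w, so [T 1] fixes each basis element from the left, hence also the unit of
    [H]. *)
Lemma T1 : T 1%g = 1.
Proof.
suff e h : T 1%g * h = h by rewrite -(e 1) mulr1.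
elim/Hecke_ind: h => [|a w h IH]; first by rewrite mulr0.
rewrite mulrDr -scalerAr IH Hecke_mul //.
  by rewrite mul1g.
by rewrite mul1g !lengthE one_mk ell_mk.
Qed.

Lemma TM x y : ell (x * y)%g = (ell x + ell y)%N -> T x * T y = T (x * y)%g.
Proof. by move=> e; apply: Hecke_mul => //; rewrite !lengthE e. Qed.

Lemma Tquad s : s \in simples -> T s * T s = xi *: T s + 1.
Proof.
move=> hs; have := Hecke_quad HT hs.
rewrite mulrDr !mulrBl -!scalerAl !mul1r -!scalerAr !mulr1 scalerA vgenK.
rewrite scale1r => e; apply/eqP; rewrite -subr_eq0 -e /xi scalerBl.
by rewrite !opprD opprK !addrA.
Qed.

Lemma commutators0 : commutators (0 : H).
Proof. by exists [::]; rewrite big_nil. Qed.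

Lemma commutatorsD h h' : commutators h -> commutators h' ->
  commutators (h + h').
Proof. by move=> [r ->] [r' ->]; exists (r ++ r'); rewrite big_cat. Qed.

Lemma commutatorsZ a h : commutators h -> commutators (a *: h).
Proof.
move=> [r ->]; exists [seq (a * p.1, p.2) | p <- r].
by rewrite big_map scaler_sumr; apply: eq_bigr => p _; rewrite scalerA.
Qed.

Lemma comm_equiv_refl h : comm_equiv h h.
Proof. by rewrite /comm_equiv subrr; apply: commutators0. Qed.

Lemma comm_equiv_eq h h' : h = h' -> comm_equiv h h'.
Proof. by move=> ->; apply: comm_equiv_refl. Qed.

Lemma comm_equiv_sym h h' : comm_equiv h h' -> comm_equiv h' h.
Proof.
by move=> e; rewrite /comm_equiv -opprB -scaleN1r; apply: commutatorsZ.
Qed.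

Lemma comm_equiv_trans h h' h'' :
  comm_equiv h h' -> comm_equiv h' h'' -> comm_equiv h h''.
Proof.
by move=> e e'; rewrite /comm_equiv -(subrKA h'); apply: commutatorsD.
Qed.

Lemma comm_equivD h h' g g' : comm_equiv h h' -> comm_equiv g g' ->
  comm_equiv (h + g) (h' + g').
Proof.
by move=> e e'; rewrite /comm_equiv opprD addrACA; apply: commutatorsD.
Qed.

Lemma comm_equivZ a h h' : comm_equiv h h' -> comm_equiv (a *: h) (a *: h').
Proof. by move=> e; rewrite /comm_equiv -scalerBr; apply: commutatorsZ. Qed.

Lemma comm_equiv_mul x y : comm_equiv (x * y : H) (y * x).
Proof. by exists [:: (1, (x, y))]; rewrite big_seq1 /= scale1r. Qed.

Lemma TtauM w : T tau * T w = T (tau * w)%g.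
Proof. by apply: TM; rewrite ell_tauM tau_mk ell_mk. Qed.

Lemma TMtau w : T w * T tau = T (w * tau)%g.
Proof. by apply: TM; rewrite ell_Mtau tau_mk ell_mk addn0. Qed.

Lemma T_conj_tau w : comm_equiv (T (tau * w * tau^-1)%g) (T w).
Proof.
have := comm_equiv_mul (T tau) (T (w * tau^-1)%g).
by rewrite TtauM TMtau mulgKV mulgA.
Qed.

(** If s w is longer than w, then T_s T_w = T_(sw) = T_(sws) T_s, and T_s is invertible with inverse
    T_s - xi. Otherwise T_w = T_s T_(sw) and T_(sws) = T_(sw) T_s are the two orders of one
    product. *)
Lemma T_conj_eq s w : s \in simples -> ell (s * w * s)%g = ell w ->
  comm_equiv (T (s * w * s)%g) (T w).
Proof.
move=> hs ew; have es := ell_simple hs.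
have [e|e] := ell_simpleM w hs.
  have e1 : T s * T w = T (s * w * s)%g * T s.
    rewrite !TM; last by rewrite e es.
      by rewrite -[in RHS]mulgA simple_sq // mulg1.
    by rewrite -mulgA simple_sq // mulg1 ew es e addn1.
  have TsV : T s * (T s - xi%:A) = 1.
    by rewrite mulrBr Tquad // -scalerAr mulr1 addrAC subrr add0r.
  have TVs : (T s - xi%:A) * T s = 1.
    by rewrite mulrBl Tquad // -scalerAl mul1r addrAC subrr add0r.
  have := comm_equiv_mul (T s * T w) (T s - xi%:A).
  by rewrite {1}e1 -mulrA TsV mulr1 mulrA TVs mul1r.
have sK : (s * (s * w) = w)%g by rewrite mulgA simple_sq ?mul1g.
have := comm_equiv_mul (T (s * w)%g) (T s).
by rewrite !TM ?sK // ?ew ?e ?es ?addn1.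
Qed.

(** Here T_w = T_s T_(sws) T_s; rotate it to T_(sws) T_s T_s and apply the quadratic relation. *)
Lemma T_conj_lt s w : s \in simples ->
  ell w = (ell (s * w * s)%g).+2 ->
  comm_equiv (T w) (T (s * w * s)%g + xi *: T (s * w)%g).
Proof.
move=> hs ew; have es := ell_simple hs.
have e1 : ell (s * w)%g = (ell (s * w * s)%g).+1.
  by have := ell_simpleM w hs; have := ell_Msimple (s * w)%g hs;
     rewrite ew; set m := ell _; set n := ell _; lia.
have sK : (s * (s * w) = w)%g by rewrite mulgA simple_sq ?mul1g.
have Ks : (s * w * s * s = s * w)%g by rewrite -mulgA simple_sq ?mulg1.
have e2 : T w = T s * (T (s * w * s)%g * T s).
  by rewrite TM ?Ks ?TM ?sK ?e1 ?es ?addn1 // ew.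
rewrite e2; apply: comm_equiv_trans (comm_equiv_mul _ _) _.
rewrite -mulrA Tquad // mulrDr mulr1 -scalerAr TM ?Ks; last by rewrite e1 es addn1.
by rewrite addrC; apply: comm_equiv_refl.
Qed.

End Hecke.

(** * Conjugacy classes *)

Lemma conj_class_refl (x : extW) : conj_class x x.
Proof. by exists 1%g => //; rewrite mul1g invg1 mulg1. Qed.

Lemma conj_class_eq (x y : extW) : conj_class x y -> conj_class x = conj_class y.
Proof.
move=> [g _ <-]; rewrite predeqE => z; split=> -[h _ <-].
  exists (h * g^-1)%g => //.
  by rewrite invMg invgK -!mulgA !(mulKVg, mulKg) .
by exists (h * g)%g => //; rewrite invMg -!mulgA.
Qed.

Lemma mk_conj c d u a b t : (mk c d u * mk a b t * (mk c d u)^-1)%g =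
  mk (c + (wt_act u a b).1 - (wt_act (wt_mul (wt_mul u t) (wt_inv u)) c d).1)
     (d + (wt_act u a b).2 - (wt_act (wt_mul (wt_mul u t) (wt_inv u)) c d).2)
     (wt_mul (wt_mul u t) (wt_inv u)).
Proof.
by rewrite mk_inv !mkM; case: u; case: t => /=; congr mk; lia.
Qed.

(* C_i for i > 0, and C'_(-i) for i < 0. *)
Definition refl_class (i : int) : set extW :=
  [set x | exists m : int, [\/ x = mk (2 * m - i) (2 * i - m) Wa,
     x = mk (- 2 * i - m) (2 * m + i) Wb | x = mk (m + i) (m - 2 * i) Waba]].

Lemma conj_class_mk c d u a b t a' b' t' :
  a' = c + (wt_act u a b).1 - (wt_act (wt_mul (wt_mul u t) (wt_inv u)) c d).1 ->
  b' = d + (wt_act u a b).2 - (wt_act (wt_mul (wt_mul u t) (wt_inv u)) c d).2 ->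
  t' = wt_mul (wt_mul u t) (wt_inv u) ->
  conj_class (mk a b t) (mk a' b' t').
Proof. by move=> -> -> ->; exists (mk c d u) => //; rewrite mk_conj. Qed.

(* Every conjugacy class contains exactly one of: t^l with l dominant,
   t^(n omega1) s1 with n an integer, t^(j omega1) s1 s2 with j < 3. *)
Definition nf : Type := (nat * nat + (int + 'I_3))%type.

Definition nf_elt (k : nf) : extW :=
  match k with
  | inl (a, b) => mk a%:Z b%:Z We
  | inr (inl n) => mk n 0 Wa
  | inr (inr j) => mk (j : nat)%:Z 0 Wab
  end.

Definition nf_class (k : nf) : set extW := conj_class (nf_elt k).

(** Conjugating t^l w by t^m adds m - w m to l. For w = s1 these shifts are the multiples of alpha1,
    on which a + 2 b vanishes; for w = s1 s2 they form Q, on which a + 2 b vanishes modulo 3. A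
    translation is moved into the dominant chamber by W. *)
Lemma nf_exists x : exists k, conj_class x = nf_class k.
Proof.
suff [k kP] : exists k, conj_class x (nf_elt k).
  by exists k; apply: conj_class_eq.
have [a [b [t ->]]] := mk_surj x; case: t.
- have dom u : 0 <= (wt_act u a b).1 -> 0 <= (wt_act u a b).2 ->
      exists k, conj_class (mk a b We) (nf_elt k).
    move=> h1 h2; exists (inl (absz (wt_act u a b).1, absz (wt_act u a b).2)).
    by apply: (@conj_class_mk 0 0 u); case: u h1 h2 => //= *; lia.
  have [h|h] : 0 <= a \/ a < 0 by lia.
    have [h'|h'] : 0 <= b \/ b < 0 by lia.
      by apply: (dom We).
    have [h''|h''] : 0 <= a + b \/ a + b < 0 by lia.
      by apply: (dom Wb) => /=; lia.
    by apply: (dom Wab) => /=; lia.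
  have [h'|h'] : 0 <= a + b \/ a + b < 0 by lia.
    by apply: (dom Wa) => /=; lia.
  have [h''|h''] : 0 <= b \/ b < 0 by lia.
    by apply: (dom Wba) => /=; lia.
  by apply: (dom Waba) => /=; lia.
- exists (inr (inl (a + 2 * b))).
  by apply: (@conj_class_mk b 0 We) => //=; lia.
- exists (inr (inl (- 2 * a - b))).
  by apply: (@conj_class_mk (- a - b) 0 Wba) => //=; lia.
- have lt3 : (absz ((a + 2 * b) %% 3)%Z < 3)%N by lia.
  exists (inr (inr (Ordinal lt3))).
  pose d := - ((a + 2 * b) %/ 3)%Z.
  by apply: (@conj_class_mk (b + d) d We); rewrite /d //=; lia.
- have lt3 : (absz ((a + 2 * b) %% 3)%Z < 3)%N by lia.
  exists (inr (inr (Ordinal lt3))).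
  pose d := - ((a + 2 * b) %/ 3)%Z.
  by apply: (@conj_class_mk (a + b + d) d Wa); rewrite /d //=; lia.
- exists (inr (inl (a - b))).
  by apply: (@conj_class_mk (- b) 0 Wb) => //=; lia.
Qed.

Lemma nf_class_inj : injective nf_class.
Proof.
move=> k k' e.
have [g _] : conj_class (nf_elt k) (nf_elt k').
  by move: (conj_class_refl (nf_elt k')); rewrite -/(nf_class k') -e.
have [c [d [u ->]]] := mk_surj g.
case: k {e} => [[a b]|[n|j]]; case: k' => [[a' b']|[n'|j']];
  rewrite /= mk_conj => /mk_inj[]; case: u => //=; try by lia.
- by move=> *; congr (inl (_, _)); lia.
- by move=> *; congr (inl (_, _)); lia.
- by move=> *; congr (inl (_, _)); lia.
- by move=> *; congr (inl (_, _)); lia.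
- by move=> *; congr (inl (_, _)); lia.
- by move=> *; congr (inl (_, _)); lia.
- by move=> *; congr (inr (inl _)); lia.
- by move=> *; congr (inr (inl _)); lia.
- have := ltn_ord j; have := ltn_ord j' => *.
  by congr (inr (inr _)); apply: val_inj => /=; lia.
- have := ltn_ord j; have := ltn_ord j' => *.
  by congr (inr (inr _)); apply: val_inj => /=; lia.
- have := ltn_ord j; have := ltn_ord j' => *.
  by congr (inr (inr _)); apply: val_inj => /=; lia.
Qed.

Lemma nf_conj_class k : conj_classes (nf_class k).
Proof. by exists (nf_elt k). Qed.

Lemma conj_classesP O : conj_classes O -> exists k, O = nf_class k.
Proof. by case=> x _ <-; apply: nf_exists. Qed.

(** The invariant a + 2 b takes the value 3 i on m alpha1 + i alpha2. *)
Lemma refl_classE i : refl_class i = nf_class (inr (inl (3 * i))).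
Proof.
rewrite predeqE => x; split.
  case=> m [] ->.
  - by apply: (@conj_class_mk (m - 2 * i) 0 We) => //=; lia.
  - by apply: (@conj_class_mk 0 (m - i) Wab) => //=; lia.
  - by apply: (@conj_class_mk (m - 2 * i) 0 Wb) => //=; lia.
case=> g _ <-; have [c [d [u ->]]] := mk_surj g; rewrite /= mk_conj.
case: u => /=.
- by exists (2 * i + c); apply: Or31; congr mk; lia.
- by exists (c - i); apply: Or31; congr mk; lia.
- by exists (2 * i + c + d); apply: Or33; congr mk; lia.
- by exists (i + d); apply: Or32; congr mk; lia.
- by exists (c + d - i); apply: Or33; congr mk; lia.
- by exists (d - 2 * i); apply: Or32; congr mk; lia.
Qed.

Lemma C_E i : C_ i = nf_class (inr (inl (3 * i%:Z))).
Proof.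
rewrite -refl_classE predeqE => x.
split=> -[m h]; exists m; move: h;
  by rewrite !root_combE ?s1_mk ?s2_mk !transl_mk !mkM /= => -[] ->;
     [apply: Or31 | apply: Or32 | apply: Or33]; congr mk; lia.
Qed.

Lemma C'_E i : C'_ i = nf_class (inr (inl (- (3 * i%:Z)))).
Proof.
rewrite -mulrN -refl_classE predeqE => x; split=> -[m].
  rewrite !root_combE ?s1_mk ?s2_mk !transl_mk !mkM /= => -[] ->.
  - by exists m; apply: Or31; congr mk; lia.
  - by exists m; apply: Or32; congr mk; lia.
  - by exists (m - i%:Z); apply: Or33; congr mk; lia.
case=> ->.
- by exists m; apply: Or31; rewrite root_combE s1_mk transl_mk mkM; congr mk => /=; lia.
- by exists m; apply: Or32; rewrite root_combE s2_mk transl_mk mkM; congr mk => /=; lia.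
- by exists (m + i%:Z); apply: Or33; rewrite root_combE s1_mk s2_mk transl_mk !mkM;
    congr mk => /=; lia.
Qed.

Lemma root_latticeP a b : root_lattice (a, b) <-> exists c, a - b = 3 * c.
Proof.
split=> [[x [y]]|[c e]].
  by rewrite root_combE => -[-> ->]; exists (x - y); lia.
by exists (b + 2 * c), (b + c); rewrite root_combE; congr pair; lia.
Qed.

Lemma O_2E : O_2 = nf_class (inr (inr ord0)).
Proof.
rewrite predeqE => x; split.
  case=> -[a b] /root_latticeP[c e]; rewrite s1_mk s2_mk !transl_mk !mkM /=.
  case=> ->.
    by apply: (@conj_class_mk c (b + c) We) => //=; lia.
  by apply: (@conj_class_mk (b + 2 * c) (- c) Wa) => //=; lia.
case=> g _ <-; have [c [d [u ->]]] := mk_surj g; rewrite /= mk_conj.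
have O2ab a b e : a - b = 3 * e -> O_2 (mk a b Wab).
  move=> abe; exists (a, b); first by apply/root_latticeP; exists e.
  by left; rewrite s1_mk s2_mk transl_mk !mkM; congr mk => /=; lia.
have O2ba a b e : a - b = 3 * e -> O_2 (mk a b Wba).
  move=> abe; exists (a, b); first by apply/root_latticeP; exists e.
  by right; rewrite s1_mk s2_mk transl_mk !mkM; congr mk => /=; lia.
case: u => /=; by [apply: (O2ab _ _ c); lia | apply: (O2ba _ _ (- d)); lia].
Qed.

Lemma O_translE (a b : nat) : O_transl (a%:Z, b%:Z) = nf_class (inl (a, b)).
Proof. by rewrite /O_transl transl_mk. Qed.

(** * Expansion of the Coxeter type elements *)

Section Reduction.
Variables (H : algType laurent) (T : extW -> H) (HT : Hecke_basis T).
Implicit Types (i m : int) (n : nat).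

(* t^(m alpha1 + i alpha2) s1, t^(- i alpha1 + m alpha2) s2 and
   t^(m alpha1 + (m - i) alpha2) s1 s2 s1. *)
Definition refl1 i m := mk (2 * m - i) (2 * i - m) Wa.
Definition refl2 i m := mk (- 2 * i - m) (2 * m + i) Wb.
Definition refl3 i m := mk (m + i) (m - 2 * i) Waba.

Lemma tau_refl1 i m : (tau * refl1 i m * tau^-1)%g = refl2 i (m - i).
Proof. by rewrite tau_mk mk_conj; congr mk => /=; lia. Qed.

Lemma tau_refl3 i m : (tau * refl3 i m * tau^-1)%g = refl1 i (1 - m + i).
Proof. by rewrite tau_mk mk_conj; congr mk => /=; lia. Qed.

Lemma s0_refl1 i m : (s0 * refl1 i m * s0)%g = refl2 i (1 - m).
Proof. by rewrite s0_mk !mkM; congr mk => /=; lia. Qed.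

Lemma s2_refl2 i m : (s2 * refl2 i m * s2)%g = refl2 i (- i - m).
Proof. by rewrite s2_mk !mkM; congr mk => /=; lia. Qed.

Lemma s2M_refl2 i m : (s2 * refl2 i m)%g = mk (m - i) (- 2 * m - i) We.
Proof. by rewrite s2_mk !mkM; congr mk => /=; lia. Qed.

Lemma s0_simple : s0 \in simples. Proof. by rewrite !inE eqxx. Qed.
Lemma s1_simple : s1 \in simples. Proof. by rewrite !inE eqxx !orbT. Qed.
Lemma s2_simple : s2 \in simples. Proof. by rewrite !inE eqxx !orbT. Qed.

Lemma T_refl2_refl1 i m : comm_equiv (T (refl2 i m)) (T (refl1 i (m + i))).
Proof. by have := T_conj_tau HT (refl1 i (m + i)); rewrite tau_refl1 addrK. Qed.

Lemma T_refl3_refl1 i m : comm_equiv (T (refl3 i m)) (T (refl1 i (1 - m + i))).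
Proof.
by apply: comm_equiv_sym; have := T_conj_tau HT (refl3 i m); rewrite tau_refl3.
Qed.

Lemma T_refl1_next i m : i != 0 -> 2 * m = i ->
  comm_equiv (T (refl1 i m)) (T (refl1 i (m + 1))).
Proof.
move=> i0 e; apply: (@comm_equiv_trans _ _ (T (refl2 i (1 - m)))).
  apply: comm_equiv_sym; rewrite -s0_refl1; apply: (T_conj_eq HT) => //.
    exact: s0_simple.
  by rewrite s0_refl1 !ell_mk /ellz /=; lia.
by have := T_refl2_refl1 i (1 - m); rewrite (_ : 1 - m + i = m + 1) //; lia.
Qed.

Lemma T_refl1_mid i m : (i != 0) -> (-1 <= 2 * m - i - 1 <= 1) ->
  comm_equiv (T (refl1 i m)) (T (refl1 i ((i + 2) %/ 2)%Z)).
Proof.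
move=> i0 h.
have [e|e] : 2 * m = i \/ m = ((i + 2) %/ 2)%Z by lia.
  have -> : ((i + 2) %/ 2)%Z = m + 1 by lia.
  exact: T_refl1_next.
by rewrite e; apply: comm_equiv_refl.
Qed.

(** The length of [refl1 i m] is |2m - i - 1| + |2i - m| + |m + i|. The last two terms add up to
    3|i| for m between -i and 2i, and the first is least at m = (i + 1)/2 for i odd, at m = i/2 and
    i/2 + 1 for i even; the floor selects the second of these. *)
Definition refl_min i : extW := refl1 i ((i + 2) %/ 2)%Z.

Definition refl_len i : nat := (3 * absz i + (if (2 %| i)%Z then 1 else 0))%N.

Lemma ell_refl_min i : i != 0 -> ell (refl_min i) = refl_len i.
Proof. by move=> i0; rewrite ell_mk /refl_len /ellz /=; case: ifP; lia. Qed.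

Lemma refl_len_le i x : refl_class i x -> (refl_len i <= ell x)%N.
Proof.
by rewrite /refl_len => -[m [] ->]; rewrite ell_mk /ellz /=; case: ifP; lia.
Qed.

Lemma T_refl_min i x : i != 0 -> refl_class i x -> ell x = refl_len i ->
  comm_equiv (T x) (T (refl_min i)).
Proof.
rewrite /refl_len => i0 [m [] ->]; rewrite ell_mk /ellz /=.
- move=> h; apply: T_refl1_mid => //.
  by move: h; case: ifP; lia.
- move=> h; apply: comm_equiv_trans (T_refl2_refl1 i m) _; apply: T_refl1_mid => //.
  by move: h; case: ifP; lia.
- move=> h; apply: comm_equiv_trans (T_refl3_refl1 i m) _; apply: T_refl1_mid => //.
  by move: h; case: ifP; lia.
Qed.

(** Conjugation by s0 keeps the length and the next one, by s2, lowers it by 2. The two bounds on m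
    say that the translation split off is regular dominant. *)
Lemma T_refl1_step (n : nat) m : m <= n%:Z -> 0 < 2 * m + n%:Z - 2 ->
  comm_equiv (T (refl1 (- n%:Z) m)) (T (refl1 (- n%:Z) (m - 1))
    + xi *: T (transl (root_comb n%:Z (n%:Z + m - 1)))).
Proof.
move=> mn m0; apply: (@comm_equiv_trans _ _ (T (refl2 (- n%:Z) (1 - m)))).
  apply: comm_equiv_sym; rewrite -s0_refl1; apply: (T_conj_eq HT) => //.
    exact: s0_simple.
  by rewrite s0_refl1 !ell_mk /ellz /=; lia.
apply: comm_equiv_trans.
  apply: (T_conj_lt HT s2_simple).
  by rewrite s2_refl2 !ell_mk /ellz /=; lia.
rewrite s2_refl2 s2M_refl2; apply: comm_equivD; last first.
  rewrite root_combE transl_mk; apply: comm_equivZ; apply: comm_equiv_eq.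
  by congr (T (mk _ _ _)); lia.
apply: comm_equiv_trans (T_refl2_refl1 _ _) _; apply: comm_equiv_eq.
by congr (T (refl1 _ _)); lia.
Qed.

Lemma T_transl_Wb a b : comm_equiv (T (mk (a + b) (- b) We)) (T (mk a b We)).
Proof.
have -> : mk (a + b) (- b) We = (s2 * mk a b We * s2)%g.
  by rewrite s2_mk !mkM; congr mk => /=; lia.
apply: (T_conj_eq HT s2_simple).
by rewrite s2_mk !mkM !ell_mk /ellz /=; lia.
Qed.

Lemma T_transl_Wa a b : comm_equiv (T (mk (- a) (a + b) We)) (T (mk a b We)).
Proof.
have -> : mk (- a) (a + b) We = (s1 * mk a b We * s1)%g.
  by rewrite s1_mk !mkM; congr mk => /=; lia.
apply: (T_conj_eq HT s1_simple).
by rewrite s1_mk !mkM !ell_mk /ellz /=; lia.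
Qed.

(** The length of a translation is invariant under W, so every conjugate is reached by simple
    reflections that keep the length. *)
Lemma T_transl_conj a b x : conj_class (mk a b We) x ->
  comm_equiv (T x) (T (mk a b We)).
Proof.
case=> g _ <-; have [c [d [u ->]]] := mk_surj g; rewrite mk_conj.
have E t : (wt_mul (wt_mul t We) (wt_inv t)) = We by case: t.
rewrite !E /= [c + _ - c]addrAC [d + _ - d]addrAC !subrr !add0r {c d g}.
have step1 p q p' q' : p' = - p -> q' = p + q ->
    comm_equiv (T (mk p q We)) (T (mk a b We)) ->
    comm_equiv (T (mk p' q' We)) (T (mk a b We)).
  by move=> -> ->; apply: comm_equiv_trans; apply: T_transl_Wa.
have step2 p q p' q' : p' = p + q -> q' = - q ->
    comm_equiv (T (mk p q We)) (T (mk a b We)) ->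
    comm_equiv (T (mk p' q' We)) (T (mk a b We)).
  by move=> -> ->; apply: comm_equiv_trans; apply: T_transl_Wb.
have r1 : comm_equiv (T (mk (- a) (a + b) We)) (T (mk a b We)).
  exact: T_transl_Wa.
have r2 : comm_equiv (T (mk (a + b) (- b) We)) (T (mk a b We)).
  exact: T_transl_Wb.
have r12 : comm_equiv (T (mk (- a - b) a We)) (T (mk a b We)).
  by apply: (step1 _ _ _ _ _ _ r2); lia.
case: u => //=.
- exact: comm_equiv_refl.
- by apply: (step2 _ _ _ _ _ _ r1); lia.
- by apply: (step2 _ _ _ _ _ _ r12); lia.
Qed.

(* The element t^(k alpha1 + (2k-1) alpha2) s1 s2 of the theorem, for k = n + 1. *)
Definition cox n := mk 1 (3 * n%:Z + 1) Wab.

Lemma cox_step n : comm_equiv (T (cox n.+1)) (T (cox n)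
  + xi *: T (refl_min (2 * n.+1%:Z - 1))
  + xi *: T (refl1 (- n.+1%:Z) n.+1%:Z)
  + xi *: T (refl_min (2 * n.+1%:Z))).
Proof.
set k : int := n.+1%:Z.
(* Conjugation by s0 keeps the length and prepares the three descents, by s1, s0 and s2. The
   summands are peeled off from the right, so the first descent yields the last one. *)
apply: (@comm_equiv_trans _ _ (T (mk (- (3 * k + 1)) 2 Wba))).
  have -> : mk (- (3 * k + 1)) 2 Wba = (s0 * cox n.+1 * s0)%g.
    by rewrite s0_mk !mkM; congr mk => /=; lia.
  apply: comm_equiv_sym; apply: (T_conj_eq HT s0_simple).
  by rewrite s0_mk !mkM !ell_mk /ellz /=; lia.
apply: comm_equiv_trans.
  apply: (T_conj_lt HT s1_simple).
  by rewrite s1_mk !mkM !ell_mk /ellz /=; lia.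
apply: comm_equivD; last first.
  apply: comm_equivZ; apply: T_refl_min => //.
  - by exists (k + 1); apply: Or33; rewrite s1_mk !mkM; congr mk => /=; lia.
  - by rewrite /refl_len s1_mk !mkM ell_mk /ellz /=; case: ifP; lia.
have -> : (s1 * mk (- (3 * k + 1)) 2 Wba * s1)%g = mk (3 * k + 1) (1 - 3 * k) Wab.
  by rewrite s1_mk !mkM; congr mk => /=; lia.
apply: comm_equiv_trans.
  apply: (T_conj_lt HT s0_simple).
  by rewrite s0_mk !mkM !ell_mk /ellz /=; lia.
apply: comm_equivD; last first.
  (* This reflection is not yet of minimal length in its class; [T_refl1_expand] reduces it. *)
  apply: comm_equivZ; apply: comm_equiv_eq; congr T.
  by rewrite s0_mk !mkM; congr mk => /=; lia.
have -> : (s0 * mk (3 * k + 1) (1 - 3 * k) Wab * s0)%g =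
    mk (3 * k - 1) (2 - 3 * k) Wba.
  by rewrite s0_mk !mkM; congr mk => /=; lia.
apply: comm_equiv_trans.
  apply: (T_conj_lt HT s2_simple).
  by rewrite s2_mk !mkM !ell_mk /ellz /=; lia.
apply: comm_equivD.
  apply: comm_equiv_eq; congr T.
  by rewrite s2_mk !mkM; congr mk => /=; lia.
apply: comm_equivZ; apply: comm_equiv_eq; congr T.
by rewrite s2_mk !mkM; congr mk => /=; lia.
Qed.

(** The elements of length 2 in O_2 are the six products of two distinct simple reflections. They
    form two orbits under conjugation by tau, and conjugation by s0 links one to the other. *)
Lemma T_cox0 x : O_2 x -> ell x = 2 -> comm_equiv (T x) (T (cox 0)).
Proof.
have tauT y : comm_equiv (T y) (T (cox 0)) ->
    comm_equiv (T (tau * y * tau^-1)%g) (T (cox 0)).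
  by apply: comm_equiv_trans; apply: T_conj_tau.
have c1 : comm_equiv (T (mk 1 1 Wab)) (T (cox 0)) by apply: comm_equiv_refl.
have c2 := tauT _ c1; rewrite tau_mk mk_conj /= in c2.
have c3 := tauT _ c2; rewrite tau_mk mk_conj /= in c3.
have d1 : comm_equiv (T (mk (- 1) 2 Wba)) (T (cox 0)).
  have -> : mk (- 1) 2 Wba = (s0 * cox 0 * s0)%g by rewrite s0_mk !mkM.
  by apply: (T_conj_eq HT s0_simple); rewrite s0_mk !mkM !ell_mk.
have d2 := tauT _ d1; rewrite tau_mk mk_conj /= in d2.
have d3 := tauT _ d2; rewrite tau_mk mk_conj /= in d3.
case=> -[a b] /root_latticeP[c e]; rewrite s1_mk s2_mk transl_mk !mkM /=.
case=> ->; rewrite ell_mk /ellz /= => h.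
  have [[ea eb]|[[ea eb]|[ea eb]]] : (a = 1 /\ b = 1) \/ (a = 0 /\ b = 0) \/
    (a = 2 /\ b = -1) by lia.
  - by rewrite ea eb.
  - by rewrite ea eb.
  - by rewrite ea eb.
have [[ea eb]|[[ea eb]|[ea eb]]] : (a = 1 /\ b = 1) \/ (a = 0 /\ b = 0) \/
  (a = -1 /\ b = 2) by lia.
- by rewrite ea eb.
- by rewrite ea eb.
- by rewrite ea eb.
Qed.

End Reduction.

Section Expansion.
Variables (H : algType laurent) (T : extW -> H) (HT : Hecke_basis T).

Lemma T_refl1_expand (n : nat) : (0 < n)%N ->
  comm_equiv (T (refl1 (- n%:Z) n%:Z)) (T (refl_min (- n%:Z))
    + \sum_(n./2.+1 <= j < n.*2) xi *: T (transl (root_comb n%:Z j%:Z))).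
Proof.
move=> n_gt0.
(* Upward induction from the minimal position m = n/2 + 1 - n (with n/2 rounded down). The step from
   t to t + 1 splits off j = n + m - 1 for the larger m, that is j = n/2 + 1 + t. *)
suff E t : (n./2.+1 + t <= n.*2)%N ->
    comm_equiv (T (refl1 (- n%:Z) ((n./2.+1 + t)%N%:Z - n%:Z)))
    (T (refl_min (- n%:Z)) + \sum_(n./2.+1 <= j < n./2.+1 + t)
       xi *: T (transl (root_comb n%:Z j%:Z))).
  have := E (n.*2 - n./2.+1)%N; rewrite subnKC; last by lia.
  by rewrite (_ : n.*2%:Z - n%:Z = n%:Z); [apply | lia].
elim: t => [|t IH] tn.
  rewrite addn0 big_geq // addr0; apply: comm_equiv_eq.
  by rewrite /refl_min; congr (T (refl1 _ _)); lia.
rewrite addnS big_nat_recr /=; last by rewrite leq_addr.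
apply: comm_equiv_trans.
  by apply: (T_refl1_step HT); lia.
rewrite [X in comm_equiv _ X]addrA; apply: comm_equivD.
  rewrite (_ : _ - 1 = (n./2.+1 + t)%N%:Z - n%:Z); last by lia.
  by apply: IH; lia.
apply: comm_equiv_eq; congr (_ *: T (transl (root_comb _ _))); lia.
Qed.

Definition class_reps (m : set extW -> extW) :=
  forall O, conj_classes O -> min_length_in O (m O).

(** All choices of representatives are included, as in [class_coefs], so a one-term expansion
    already contains the well-definedness of T_O for its class. *)
Definition expands (h : H) (e : seq (laurent * nf)) : Prop :=
  forall m, class_reps m ->
    comm_equiv h (\sum_(p <- e) p.1 *: T (m (nf_class p.2))).

Lemma expands_trans h h' e : comm_equiv h h' -> expands h' e -> expands h e.
Proof. by move=> hh' he m hm; apply: comm_equiv_trans hh' (he m hm). Qed.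

Lemma expandsZ a h e : expands h e ->
  expands (a *: h) [seq (a * p.1, p.2) | p <- e].
Proof.
move=> he m hm; rewrite big_map /=.
under eq_bigr do rewrite -scalerA.
by rewrite -scaler_sumr; apply: comm_equivZ; apply: he.
Qed.

Lemma expands1 h k :
  (forall x, min_length_in (nf_class k) x -> comm_equiv h (T x)) ->
  expands h [:: (1, k)].
Proof.
move=> hx m hm; rewrite big_seq1 scale1r; apply/hx/hm; exact: nf_conj_class.
Qed.

Definition nf_refl (i : int) : nf := inr (inl (3 * i)).
(** The coordinates of x alpha1 + j alpha2 in the fundamental coweights; the truncated differences
    are exact when this coweight is dominant. *)
Definition nf_transl (x j : nat) : nf := inl ((x.*2 - j)%N, (j.*2 - x)%N).
Definition nf_cox : nf := inr (inr ord0).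

Lemma expands_refl i : i != 0 -> expands (T (refl_min i)) [:: (1, nf_refl i)].
Proof.
move=> i0; apply: expands1 => x; rewrite -refl_classE => -[xi min_x].
have cm : refl_class i (refl_min i) by exists ((i + 2) %/ 2)%Z; apply: Or31.
apply: comm_equiv_sym; apply: (T_refl_min HT) => //; apply/eqP.
rewrite eqn_leq refl_len_le // andbT -ell_refl_min // -!lengthE.
exact: min_x.
Qed.

Lemma expands_transl x j : (x <= j.*2)%N -> (j <= x.*2)%N ->
  expands (T (transl (root_comb x%:Z j%:Z))) [:: (1, nf_transl x j)].
Proof.
move=> xj jx; apply: expands1 => y [yc _].
have -> : transl (root_comb x%:Z j%:Z) = nf_elt (nf_transl x j).
  by rewrite root_combE transl_mk; congr mk; lia.
by apply: comm_equiv_sym; apply: (T_transl_conj HT).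
Qed.

Lemma expands_cox0 : expands (T (cox 0)) [:: (1, nf_cox)].
Proof.
apply: expands1 => x; rewrite -O_2E => -[Ox min_x].
apply: comm_equiv_sym; apply: (T_cox0 HT) => //.
have Oc : O_2 (cox 0).
  rewrite /cox O_2E; apply: (@conj_class_mk 0 1 We) => //=; lia.
have := min_x _ Oc; rewrite !lengthE [ell (cox 0)]ell_mk /ellz /= => le2.
move: Ox le2 => [[a b] /root_latticeP[c e]]; rewrite s1_mk s2_mk transl_mk !mkM /=.
by case=> ->; rewrite ell_mk /ellz /=; lia.
Qed.

(** The terms by which [cox n] exceeds its predecessor. The range of j is n < 2j and j < 2n, that
    is, n alpha1 + j alpha2 is regular dominant. *)
Definition block (n : nat) : seq (laurent * nf) :=
  [:: (xi, nf_refl (2 * n%:Z)); (xi, nf_refl (2 * n%:Z - 1));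
      (xi, nf_refl (- n%:Z))] ++
  [seq (xi ^+ 2, nf_transl n j) | j <- index_iota n./2.+1 n.*2].

Fixpoint cox_terms (n : nat) : seq (laurent * nf) :=
  match n with 0 => [:: (1, nf_cox)] | n'.+1 => block n ++ cox_terms n' end.

Lemma expands_cox n : expands (T (cox n)) (cox_terms n).
Proof.
elim: n => [|n IH]; first exact: expands_cox0.
apply: (expands_trans (cox_step HT n)).
move=> m hm /=; rewrite !big_cons big_cat big_map /=.
rewrite [X in comm_equiv X _]addrC; apply: comm_equivD.
  have n0 : (2 * n.+1%:Z : int) != 0 by [].
  by have := expandsZ xi (expands_refl n0) hm; rewrite big_seq1 /= mulr1.
rewrite [X in comm_equiv X _]addrAC [X in comm_equiv X _]addrC; apply: comm_equivD.
  have n0 : (2 * n.+1%:Z - 1 : int) != 0 by lia.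
  by have := expandsZ xi (expands_refl n0) hm; rewrite big_seq1 /= mulr1.
rewrite [X in comm_equiv X _]addrC; apply: comm_equiv_trans.
  apply: comm_equivD; last exact: (IH m hm).
  exact: comm_equivZ (T_refl1_expand (ltn0Sn n)).
rewrite scalerDr -[X in comm_equiv X _]addrA; apply: comm_equivD.
  have n0 : (- n.+1%:Z : int) != 0 by [].
  by have := expandsZ xi (expands_refl n0) hm; rewrite big_seq1 /= mulr1.
apply: comm_equivD; last exact: comm_equiv_refl.
rewrite scaler_sumr !big_seq; apply: (big_ind2 (@comm_equiv H)).
- exact: comm_equiv_refl.
- by move=> *; apply: comm_equivD.
- move=> j; rewrite mem_index_iota => jn; rewrite scalerA -expr2.
  have xj : (n.+1 <= j.*2)%N by lia.
  have jx : (j <= n.+1.*2)%N by lia.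
  by have := expandsZ (xi ^+ 2) (expands_transl xj jx) hm; rewrite big_seq1 /= mulr1.
Qed.

End Expansion.

(** * Representations of the Hecke algebra *)

(* On elements of length 0: the j < 3 with w = tau^j. *)
Definition tau_deg (w : extW) : nat :=
  match wt_of w.2 with Wab => 1 | Wba => 2 | _ => 0 end%N.

Definition descent (w : extW) : extW :=
  if (ell (s0 * w)%g < ell w)%N then s0
  else if (ell (s1 * w)%g < ell w)%N then s1 else s2.

Lemma descentP w : (0 < ell w)%N ->
  descent w \in simples /\ ell w = (ell (descent w * w)%g).+1.
Proof.
move=> /ell_gt0_descent[s hs es].
have lt t : (ell (t * w)%g < ell w)%N -> t \in simples ->
    ell w = (ell (t * w)%g).+1.
  move=> h ht; move: h; case: (ell_simpleM w ht) => // ->.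
  by rewrite ltnNge leqnSn.
rewrite /descent; case: ifP => [h|/negbT h0].
  by split; [exact: s0_simple | exact: (lt s0 h s0_simple)].
case: ifP => [h|/negbT h1].
  by split; [exact: s1_simple | exact: (lt s1 h s1_simple)].
move: h0 h1 es; rewrite !inE in hs.
case/or3P: hs => /eqP-> h0 h1 e; last by split=> //; exact: s2_simple.
  by move: h0; rewrite e ltnS leqnn.
by move: h1; rewrite e ltnS leqnn.
Qed.

(** Two descents s and t generate a parabolic subgroup of type A2, whose longest element sts = tst
    splits off from w on the left with additive lengths. *)
Lemma braid_descent s t w : s \in simples -> t \in simples -> s != t ->
  ell w = (ell (s * w)%g).+1 -> ell w = (ell (t * w)%g).+1 ->
  [/\ ell (s * w)%g = (ell (t * (s * w))%g).+1,
      ell (t * (s * w))%g = (ell (s * (t * (s * w)))%g).+1 &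
      (s * (t * (s * w)) = t * (s * (t * w)))%g].
Proof.
have [a [b [u ->]]] := mk_surj w.
rewrite !inE => /or3P[]/eqP-> /or3P[]/eqP->; rewrite ?eqxx // => _;
  rewrite ?(s0_mk, s1_mk, s2_mk) !mkM !ell_mk /ellz;
  case: u => /= e1 e2; split; try lia; congr mk; lia.
Qed.

Lemma tau_conj_simple s : s \in simples -> (tau * s * tau^-1)%g \in simples.
Proof.
by rewrite !inE => /or3P[]/eqP->; rewrite ?(tau_s0, tau_s1, tau_s2) eqxx ?orbT.
Qed.

(* c and m are the images of T_tau and v T_(s1), and q = v^2; with this
   normalization no negative power of v is needed. *)
Section HeckeRep.
Variables (A : nzRingType) (c m q : A).

Definition gen (s : extW) : A :=
  if s == s0 then c * c * m * c else if s == s1 then m else c * m * (c * c).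

Fixpoint rho_rec (n : nat) (w : extW) : A :=
  match n with
  | 0 => c ^+ tau_deg w
  | n'.+1 => gen (descent w) * rho_rec n' (descent w * w)%g
  end.

Definition rho (w : extW) : A := rho_rec (ell w) w.

(** The images of s2 and s0 are the conjugates of [m] by [c] and [c ^+ 2], so one quadratic and one
    braid relation imply the others by conjugation with [c]. *)
Record Hecke_datum : Prop := {
  datum_c3 : c * (c * c) = 1;
  datum_quad : m * m = (q - 1) * m + q;
  datum_braid : m * gen s2 * m = gen s2 * m * gen s2;
  datum_q : forall x, q * x = x * q }.

Hypothesis D : Hecke_datum.

Lemma s01_neq : (s0 == s1) = false.
Proof. by apply/negbTE/eqP; rewrite s0_mk s1_mk => /mk_inj[]. Qed.
Lemma s20_neq : (s2 == s0) = false.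
Proof. by apply/negbTE/eqP; rewrite s0_mk s2_mk => /mk_inj[]. Qed.
Lemma s21_neq : (s2 == s1) = false.
Proof. by apply/negbTE/eqP; rewrite s1_mk s2_mk => /mk_inj[]. Qed.

Lemma gen0 : gen s0 = c * c * m * c. Proof. by rewrite /gen eqxx. Qed.
Lemma gen1 : gen s1 = m.
Proof. by rewrite /gen eq_sym s01_neq eqxx. Qed.
Lemma gen2 : gen s2 = c * m * (c * c).
Proof. by rewrite /gen s20_neq s21_neq. Qed.

Lemma c3 x : c * (c * (c * x)) = x.
Proof. by rewrite !mulrA -[c * c * c]mulrA (datum_c3 D) mul1r. Qed.

Lemma gen_tau s : s \in simples -> gen (tau * s * tau^-1)%g * c = c * gen s.
Proof.
rewrite !inE => /or3P[]/eqP->; rewrite ?(tau_s0, tau_s1, tau_s2) ?(gen0, gen1, gen2).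
- by rewrite -!mulrA c3.
- by rewrite -!mulrA (datum_c3 D) mulr1.
- by rewrite !mulrA.
Qed.

Lemma gen_quad s : s \in simples -> gen s * gen s = (q - 1) * gen s + q.
Proof.
have Q x y : c * (c * c) = 1 -> x * y = 1 -> y * x = 1 ->
    (x * m * y) * (x * m * y) = (q - 1) * (x * m * y) + q.
  move=> _ xy yx.
  have -> : x * m * y * (x * m * y) = x * (m * m) * y.
    by rewrite !mulrA -[x * m * y * x]mulrA yx mulr1.
  rewrite (datum_quad D) mulrDr mulrDl -[x * q](datum_q D) -(mulrA q) xy mulr1.
  congr (_ + _); rewrite !mulrA; congr (_ * _ * _).
  by rewrite mulrBr mulrBl mulr1 mul1r (datum_q D).
have cc := datum_c3 D.
have cc' : c * c * c = 1 by rewrite -mulrA.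
rewrite !inE => /or3P[]/eqP->; rewrite ?(gen0, gen1, gen2).
- exact: Q.
- exact: datum_quad.
- exact: Q.
Qed.

Lemma gen_braid12 : gen s1 * gen s2 * gen s1 = gen s2 * gen s1 * gen s2.
Proof. by rewrite gen1; apply: datum_braid. Qed.

Lemma gen_braid_tau s t : s \in simples -> t \in simples ->
  gen s * gen t * gen s = gen t * gen s * gen t ->
  let s' := (tau * s * tau^-1)%g in let t' := (tau * t * tau^-1)%g in
  gen s' * gen t' * gen s' = gen t' * gen s' * gen t'.
Proof.
move=> hs ht e s' t'.
have E x : gen (tau * x * tau^-1)%g * c = c * gen x ->
    gen (tau * x * tau^-1)%g = c * gen x * (c * c).
  by move=> <-; rewrite -mulrA (datum_c3 D) mulr1.
have [es et] := (E _ (gen_tau hs), E _ (gen_tau ht)).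
have K x y : c * x * (c * c) * (c * y * (c * c)) = c * (x * y) * (c * c).
  by rewrite -!mulrA c3.
by rewrite /s' /t' es et !K e.
Qed.

Lemma gen_braid s t : s \in simples -> t \in simples -> s != t ->
  gen s * gen t * gen s = gen t * gen s * gen t.
Proof.
have b12 := gen_braid12.
have b20 := gen_braid_tau s1_simple s2_simple b12; rewrite /= tau_s1 tau_s2 in b20.
have b01 := gen_braid_tau s2_simple s0_simple b20; rewrite /= tau_s2 tau_s0 in b01.
by rewrite !inE => /or3P[]/eqP-> /or3P[]/eqP->; rewrite ?eqxx.
Qed.

(* Matsumoto's theorem: two left descents s and t of w satisfy w = s t s u with
   lengths adding up, so the braid relation shows that rho w does not depend on
   the descent chosen to define it. *)
Lemma rho_descent s w : s \in simples -> ell w = (ell (s * w)%g).+1 ->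
  rho w = gen s * rho (s * w)%g.
Proof.
move=> hs es; move: {2}(ell w) (leqnn (ell w)) => n.
elim: n s w hs es => [|n IH] s w hs es wn; first by rewrite es in wn.
have [ht et] : descent w \in simples /\ ell w = (ell (descent w * w)%g).+1.
  by apply: descentP; rewrite es.
have rt : rho w = gen (descent w) * rho (descent w * w)%g.
  by rewrite /rho et /=.
have [e|st] := eqVneq s (descent w); first by rewrite rt -e.
rewrite rt; move: (descent w) ht et st {rt} => t ht et st.
have ts : t != s by rewrite eq_sym.
have [a1 a2 a3] := braid_descent hs ht st es et.
have [b1 b2 b3] := braid_descent ht hs ts et es.
have sn : (ell (s * w)%g <= n)%N by rewrite -ltnS -es.
have tn : (ell (t * w)%g <= n)%N by rewrite -ltnS -et.
rewrite (IH t (s * w)%g ht a1 sn) (IH s (t * w)%g hs b1 tn).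
have sn' : (ell (t * (s * w))%g <= n)%N.
  by apply: leq_trans sn; rewrite a1 leqnSn.
have tn' : (ell (s * (t * w))%g <= n)%N.
  by apply: leq_trans tn; rewrite b1 leqnSn.
rewrite (IH s _ hs a2 sn') (IH t _ ht b2 tn') a3 !mulrA.
by rewrite (gen_braid hs ht st).
Qed.

Lemma rho_asc s w : s \in simples -> ell (s * w)%g = (ell w).+1 ->
  gen s * rho w = rho (s * w)%g.
Proof.
move=> hs e; rewrite (rho_descent (s := s) (w := (s * w)%g)) //.
  by rewrite mulgA simple_sq // mul1g.
by rewrite mulgA simple_sq // mul1g.
Qed.

Lemma rho_desc s w : s \in simples -> ell w = (ell (s * w)%g).+1 ->
  gen s * rho w = (q - 1) * rho w + q * rho (s * w)%g.
Proof.
move=> hs e; rewrite (rho_descent hs e) mulrA gen_quad // mulrDl -!mulrA.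
by [].
Qed.

(** Move tau past a first letter, tau s = (tau s tau^-1) tau, and use induction on the length; the
    base case is c^3 = 1. *)
Lemma rho_tau w : c * rho w = rho (tau * w)%g.
Proof.
move: {2}(ell w) (erefl (ell w)) => n; elim: n w => [|n IH] w ew.
  have cc := datum_c3 D.
  have [->|->|->] := ell_eq0 ew.
  - by rewrite /rho tau_mk mulg1 one_mk !ell_mk /= /tau_deg !perm_ofK /= mulr1.
  - by rewrite /rho tau_mk !mkM !ell_mk /= /tau_deg !perm_ofK /= expr2.
  - by rewrite /rho tau_mk !mkM !ell_mk /= /tau_deg !perm_ofK /= expr2 cc.
have [ht et] : descent w \in simples /\ ell w = (ell (descent w * w)%g).+1.
  by apply: descentP; rewrite ew.
move: (descent w) ht et => s hs es.
rewrite (rho_descent hs es) mulrA -gen_tau // -mulrA IH; last first.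
  by apply: succn_inj; rewrite -es.
have e : (tau * s * tau^-1 * (tau * w) = tau * (s * w))%g.
  by move: (tau) => t; rewrite -!mulgA mulKg.
rewrite [RHS](rho_descent (tau_conj_simple hs)) e //.
by rewrite !ell_tauM.
Qed.

Lemma rho1 : rho 1%g = 1.
Proof. by rewrite /rho one_mk ell_mk /= /tau_deg perm_ofK. Qed.

Lemma rho_gen s : s \in simples -> rho s = gen s.
Proof.
move=> hs; rewrite -[s in LHS]mulg1 -(rho_asc hs); first by rewrite rho1 mulr1.
by rewrite mulg1 (ell_simple hs) one_mk ell_mk.
Qed.

Lemma rho_tau1 : rho tau = c.
Proof. by rewrite -[tau]mulg1 -rho_tau rho1 mulr1. Qed.

Lemma rho_comm z : z * c = c * z -> z * m = m * z ->
  forall w, z * rho w = rho w * z.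
Proof.
move=> zc zm.
have zg s : z * gen s = gen s * z.
  rewrite /gen; do 2?case: ifP => _ //.
    by rewrite !mulrA zc -[c * z * c]mulrA zc !mulrA -[_ * z * m]mulrA zm
      !mulrA -[_ * z * c]mulrA zc !mulrA.
  by rewrite !mulrA zc -[c * z * m]mulrA zm !mulrA -[_ * z * c]mulrA zc !mulrA
    -[_ * z * c]mulrA zc !mulrA.
elim/extW_ind => [|w IH|s w hs es IH].
- by rewrite rho1 mulr1 mul1r.
- by rewrite -rho_tau mulrA zc -mulrA IH mulrA.
- by rewrite -rho_asc // mulrA zg -mulrA IH mulrA.
Qed.

(** At q = 1 the generators square to 1, so multiplication by s has the same form whether or not it
    raises the length. *)
Lemma rhoM x y : q = 1 -> rho (x * y)%g = rho x * rho y.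
Proof.
move=> q1; elim/extW_ind: x => [|x IH|s x hs es IH].
- by rewrite rho1 mul1r mul1g.
- by rewrite -mulgA -!rho_tau IH mulrA.
rewrite -mulgA -(rho_asc hs es) -mulrA -IH.
case: (ell_simpleM (x * y)%g hs) => e; first by rewrite rho_asc.
by rewrite (rho_desc hs e) q1 subrr mul0r add0r mul1r.
Qed.

End HeckeRep.

Lemma rho_map (A B : nzRingType) (f : {rmorphism A -> B}) (c m : A) w :
  f (rho c m w) = rho (f c) (f m) w.
Proof.
rewrite /rho; move: (ell w) => n; elim: n w => [|n IH] w /=.
  by rewrite rmorphXn.
by rewrite rmorphM IH /gen; do 2?case: ifP => _; rewrite ?rmorphM.
Qed.

(** * Extension of scalars from Laurent polynomials to Q(z)(v) *)

Local Notation zfrac := {fraction {poly int}}.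
Local Notation vfrac := {fraction {poly zfrac}}.
Local Notation tofrac := FracField.tofrac.

(** The indeterminate of [zfrac] is the parameter z. Here it enters only through the constants: the
    indeterminate of [p] is v and remains the outer one. *)
Definition lift_poly (p : {poly int}) : {poly zfrac} := map_poly intr p.

Lemma lift_polyM p r : lift_poly (p * r) = lift_poly p * lift_poly r.
Proof. exact: rmorphM. Qed.
Lemma lift_polyB p r : lift_poly (p - r) = lift_poly p - lift_poly r.
Proof. exact: rmorphB. Qed.
Lemma lift_polyXn n : lift_poly 'X^n = 'X^n.
Proof. exact: map_polyXn. Qed.

Local Notation Xf := (tofrac ('X : {poly zfrac})).

Lemma Xf_neq0 : Xf != 0.
Proof. by rewrite tofrac_eq0 polyX_eq0. Qed.

Lemma Xfn_neq0 n : Xf ^+ n != 0.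
Proof. by rewrite expf_neq0 // Xf_neq0. Qed.

(** A numerator and an exponent are known only to exist, so a pair is chosen; [laurent_evalE] shows
    that the value is the same for every pair. *)
Definition laurent_eval (a : laurent) : vfrac :=
  let: exist (p, n) _ := cid (let: ex_intro p (ex_intro n e) :=
      elimT (is_laurentP _) (valP a) in
      ex_intro (fun pn : {poly int} * nat => val a = tofrac pn.1 / tofrac 'X ^+ pn.2)
        (p, n) e) in
  tofrac (lift_poly p) / Xf ^+ n.

Lemma laurent_evalE (a : laurent) p n :
  val a = tofrac p / tofrac 'X ^+ n ->
  laurent_eval a = tofrac (lift_poly p) / Xf ^+ n.
Proof.
rewrite /laurent_eval; case: cid => -[p' n'] /= -> /eqP.
have X0 k : tofrac ('X : {poly int}) ^+ k != 0.
  by rewrite expf_neq0 // tofrac_eq0 polyX_eq0.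
move=> e0; have {e0} /eqP e : p' * 'X^n == p * 'X^n'.
  by rewrite -tofrac_eq !tofracM !tofracXn -eqr_div.
apply/eqP; rewrite eqr_div ?Xfn_neq0 // -!tofracXn -!tofracM tofrac_eq.
by rewrite -!lift_polyXn -!lift_polyM e.
Qed.

Lemma laurent_exists (a : laurent) : exists p n, val a = tofrac p / tofrac 'X ^+ n.
Proof. exact: elimT (is_laurentP _) (valP a). Qed.

Lemma laurent_eval_is_zmod_morphism : zmod_morphism laurent_eval.
Proof.
move=> a b; have [p [n ea]] := laurent_exists a; have [r [m eb]] := laurent_exists b.
have X0 k : tofrac ('X : {poly int}) ^+ k != 0.
  by rewrite expf_neq0 // tofrac_eq0 polyX_eq0.
rewrite (laurent_evalE ea) (laurent_evalE eb).
rewrite (@laurent_evalE _ (p * 'X^m - r * 'X^n) (n + m)).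
  rewrite -[in RHS]mulNr [RHS]addf_div ?Xfn_neq0 // exprD lift_polyB
    !lift_polyM !lift_polyXn.
  by rewrite tofracB !tofracM !tofracXn mulNr.
have -> : val (a - b) = val a - val b by [].
rewrite ea eb -[in LHS]mulNr [LHS]addf_div // exprD tofracB !tofracM !tofracXn mulNr.
by [].
Qed.

Lemma laurent_eval_is_monoid_morphism : monoid_morphism laurent_eval.
Proof.
split.
  rewrite (@laurent_evalE _ 1 0); first by rewrite /lift_poly rmorph1 tofrac1 expr0 divr1.
  by rewrite rmorph1 tofrac1 expr0 divr1.
move=> a b; have [p [n ea]] := laurent_exists a; have [r [m eb]] := laurent_exists b.
rewrite (laurent_evalE ea) (laurent_evalE eb) (@laurent_evalE _ (p * r) (n + m)).
  by rewrite mulf_div exprD lift_polyM tofracM.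
have -> : val (a * b) = val a * val b by [].
by rewrite ea eb mulf_div exprD tofracM.
Qed.

HB.instance Definition _ := GRing.isZmodMorphism.Build laurent vfrac laurent_eval
  laurent_eval_is_zmod_morphism.
HB.instance Definition _ := GRing.isMonoidMorphism.Build laurent vfrac laurent_eval
  laurent_eval_is_monoid_morphism.

Lemma laurent_eval_vgen : laurent_eval vgen = Xf.
Proof.
rewrite (@laurent_evalE _ 'X 0); last by rewrite expr0 divr1.
by rewrite expr0 divr1 /lift_poly map_polyX.
Qed.

Lemma laurent_eval_vinv : laurent_eval vinv = Xf^-1.
Proof.
rewrite (@laurent_evalE _ 1 1); last by rewrite tofrac1 expr1 div1r.
by rewrite expr1 /lift_poly rmorph1 tofrac1 div1r.
Qed.

Lemma laurent_eval_xi : laurent_eval xi = Xf - Xf^-1.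
Proof. by rewrite /xi rmorphB /= laurent_eval_vgen laurent_eval_vinv. Qed.

(** * Trace functions on the cocenter *)

Lemma TsM_asc (H : algType laurent) (T : extW -> H) (HT : Hecke_basis T) s w :
  s \in simples -> ell (s * w)%g = (ell w).+1 -> T s * T w = T (s * w)%g.
Proof. by move=> hs e; rewrite (TM HT) // e (ell_simple hs) add1n. Qed.

Lemma TsM_desc (H : algType laurent) (T : extW -> H) (HT : Hecke_basis T) s w :
  s \in simples -> ell w = (ell (s * w)%g).+1 ->
  T s * T w = xi *: T w + T (s * w)%g.
Proof.
move=> hs e; have sK : (s * (s * w) = w)%g by rewrite mulgA simple_sq ?mul1g.
have ew : T w = T s * T (s * w)%g by rewrite (TsM_asc HT) ?sK.
by rewrite {1}ew mulrA (Tquad HT) // mulrDl mul1r -scalerAl -ew.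
Qed.

Section TraceOfRep.
Variables (H : algType laurent) (T : extW -> H) (HT : Hecke_basis T).
Variables (K : fieldType) (f : {rmorphism laurent -> K}) (A : algType K).
Variables (r : extW -> A) (z : A) (tr : A -> K).
Hypotheses (r1 : r 1%g = 1)
  (r_tau : forall w, r tau * r w = r (tau * w)%g)
  (r_asc : forall s w, s \in simples -> ell (s * w)%g = (ell w).+1 ->
     r s * r w = r (s * w)%g)
  (r_desc : forall s w, s \in simples -> ell w = (ell (s * w)%g).+1 ->
     r s * r w = f xi *: r w + r (s * w)%g)
  (rz : forall w, r w * z = z * r w)
  (trD : forall a x y, tr (a *: x + y) = a * tr x + tr y)
  (trC : forall x y, tr (x * y) = tr (y * x)).

Definition Rho (h : H) : A :=
  \sum_(w \in [set: extW]) f (coord HT h w) *: r w.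

Lemma Rho_seq h e : uniq e -> (forall w, coord HT h w != 0 -> w \in e) ->
  Rho h = \sum_(w <- e) f (coord HT h w) *: r w.
Proof.
move=> ur sr; apply: fsum_seq => // w _; apply: contraNeq => hw; apply: sr.
by apply: contraNneq hw => ->; rewrite rmorph0 scale0r.
Qed.

Lemma RhoD a h h' : Rho (a *: h + h') = f a *: Rho h + Rho h'.
Proof.
have [e1 _ m1] := suppP HT h; have [e2 _ m2] := suppP HT h'.
set e := undup (e1 ++ e2).
have ue : uniq e by apply: undup_uniq.
have e1e w : coord HT h w != 0 -> w \in e.
  by rewrite -m1 /e mem_undup mem_cat => ->.
have e2e w : coord HT h' w != 0 -> w \in e.
  by rewrite -m2 /e mem_undup mem_cat orbC => ->.
rewrite (Rho_seq ue e1e) (Rho_seq ue e2e) (@Rho_seq (a *: h + h') e ue).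
  rewrite scaler_sumr -big_split /=; apply: eq_bigr => w _.
  by rewrite coordD rmorphD rmorphM scalerDl scalerA.
move=> w; rewrite coordD; apply: contraNT => we.
have -> : coord HT h w = 0 by apply/eqP; apply: contraNT we; apply: e1e.
have -> : coord HT h' w = 0 by apply/eqP; apply: contraNT we; apply: e2e.
by rewrite mulr0 addr0.
Qed.

Lemma Rho_T w : Rho (T w) = r w.
Proof.
rewrite (@Rho_seq _ [:: w]) //.
  by rewrite big_seq1 coordT eqxx rmorph1 scale1r.
by move=> u; rewrite coordT inE; case: (u == w); rewrite ?eqxx.
Qed.

Lemma Rho0 : Rho 0 = 0.
Proof.
have := RhoD (-1) 0 0; rewrite scaleN1r oppr0 addr0 rmorphN1 scaleN1r addNr.
by [].
Qed.

(** It is enough to treat left multiplication by [T tau] and [T s] on basis elements, where [T] and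
    [r] obey the same rules. *)
Lemma Rho_TM w h : Rho (T w * h) = r w * Rho h.
Proof.
have step x : (forall y, Rho (T x * T y) = r x * r y) ->
    forall h, Rho (T x * h) = r x * Rho h.
  move=> hx; elim/(Hecke_ind HT) => [|a u g IH]; first by rewrite mulr0 Rho0 mulr0.
  by rewrite mulrDr -scalerAr !RhoD IH hx Rho_T mulrDr scalerAr.
elim/extW_ind: w h => [|w IH|s w hs es IH] h.
- by rewrite (T1 HT) r1 !mul1r.
- rewrite -(TtauM HT) -mulrA step ?IH ?mulrA ?r_tau // => y.
  by rewrite (TtauM HT) Rho_T r_tau.
- rewrite -(TsM_asc HT hs es) -mulrA step ?IH ?mulrA ?r_asc // => y.
  case: (ell_simpleM y hs) => e.
    by rewrite (TsM_asc HT) // Rho_T r_asc.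
  by rewrite (TsM_desc HT) // RhoD !Rho_T r_desc.
Qed.

Lemma RhoM x y : Rho (x * y) = Rho x * Rho y.
Proof.
elim/(Hecke_ind HT): x => [|a w g IH]; first by rewrite mul0r Rho0 mul0r.
by rewrite mulrDl -scalerAl !RhoD IH Rho_TM Rho_T mulrDl scalerAl.
Qed.

(** Since z commutes with the image of H, this is again a trace function. Taking for z a power of
    the image of tau makes the trace sensitive to the component in Z/3. *)
Definition trz (h : H) : K := tr (Rho h * z).

Lemma trzD a h h' : trz (a *: h + h') = f a * trz h + trz h'.
Proof. by rewrite /trz RhoD mulrDl -scalerAl trD. Qed.

Lemma Rho_z h : Rho h * z = z * Rho h.
Proof.
elim/(Hecke_ind HT): h => [|a w g IH]; first by rewrite Rho0 mulr0 mul0r.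
by rewrite RhoD mulrDl mulrDr IH Rho_T -scalerAl -scalerAr rz.
Qed.

Lemma trz0 : trz 0 = 0.
Proof.
have := trzD (-1) 0 0; rewrite scaleN1r oppr0 addr0 rmorphN1 mulN1r addNr.
by [].
Qed.

Lemma trzC x y : trz (x * y) = trz (y * x).
Proof. by rewrite /trz !RhoM -mulrA Rho_z mulrA trC mulrA. Qed.

Lemma trz_commutators h : commutators h -> trz h = 0.
Proof.
case=> e ->; elim: e => [|p e IH]; first by rewrite big_nil trz0.
rewrite big_cons trzD IH addr0.
have -> : trz (p.2.1 * p.2.2 - p.2.2 * p.2.1) = 0.
  by rewrite addrC -scaleN1r trzD rmorphN1 trzC mulN1r addNr.
by rewrite mulr0.
Qed.

Lemma trz_sum (I : Type) (e : seq I) (a : I -> laurent) (h : I -> H) :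
  trz (\sum_(i <- e) a i *: h i) = \sum_(i <- e) f (a i) * trz (h i).
Proof.
elim: e => [|i e IH]; first by rewrite !big_nil trz0.
by rewrite !big_cons trzD IH.
Qed.

Lemma trace_of_rep_relation (I : Type) (e : seq I) (a : I -> laurent) (w : I -> extW) :
  commutators (\sum_(i <- e) a i *: T (w i)) ->
  \sum_(i <- e) f (a i) * tr (r (w i) * z) = 0.
Proof.
move=> /trz_commutators; rewrite trz_sum => e0; rewrite -[RHS]e0.
by apply: eq_bigr => i _; rewrite /trz Rho_T.
Qed.

End TraceOfRep.

Lemma quad_coef1 (R : fieldType) (x y : R) : x != 0 -> y != 0 ->
  x^-1 / (x * y) * x ^+ 2 - x^-1 / (x * y) = (x - x^-1) / (x * y).
Proof. by move=> x0 y0; field; rewrite x0 y0. Qed.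

Lemma quad_coef2 (R : fieldType) (x y : R) : x != 0 -> y != 0 ->
  x^-1 / (x * y) * x ^+ 2 = y^-1.
Proof. by move=> x0 y0; field; rewrite x0 y0. Qed.

Section TraceFunctional.
Variables (H : algType laurent) (T : extW -> H) (HT : Hecke_basis T).
Local Notation B := {poly zfrac}.
Local Notation tofrac := FracField.tofrac.
Local Notation Xf := (tofrac ('X : B)).
Variables (n : nat) (c m z : 'M[B]_n.+1).
Hypothesis D : Hecke_datum c m ('X^2)%:M.
Hypotheses (zc : z * c = c * z) (zm : z * m = m * z).

Definition fracmx (x : 'M[B]_n.+1) : 'M[vfrac]_n.+1 := map_mx (@FracField.tofrac B) x.

Lemma fracmxM x y : fracmx (x * y) = fracmx x * fracmx y.
Proof. exact: map_mxM. Qed.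

(** As [m] stands for v T_(s1), [rho c m w] stands for v^(ell w) T_w; the factor removes this power
    of v. *)
Definition rhoK (w : extW) : 'M[vfrac]_n.+1 :=
  (Xf ^- ell w) *: fracmx (rho c m w).

Lemma rhoK1 : rhoK 1%g = 1.
Proof.
by rewrite /rhoK rho1 one_mk ell_mk /= expr0 invr1 scale1r /fracmx map_mx1.
Qed.

Lemma rhoK_tau w : rhoK tau * rhoK w = rhoK (tau * w)%g.
Proof.
rewrite /rhoK ell_tauM -scalerAl -scalerAr -fracmxM.
have -> : ell tau = 0%N by rewrite tau_mk ell_mk.
rewrite expr0 invr1 scale1r -[in RHS](rho_tau D); congr (_ *: fracmx (_ * _)).
by rewrite (rho_tau1 D).
Qed.

Lemma rhoK_asc s w : s \in simples -> ell (s * w)%g = (ell w).+1 ->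
  rhoK s * rhoK w = rhoK (s * w)%g.
Proof.
move=> hs e; rewrite /rhoK -scalerAl -scalerAr -fracmxM scalerA (rho_gen D) //.
by rewrite (rho_asc D hs e) e (ell_simple hs) expr1 exprS invfM.
Qed.

Lemma rhoK_desc s w : s \in simples -> ell w = (ell (s * w)%g).+1 ->
  rhoK s * rhoK w = laurent_eval xi *: rhoK w + rhoK (s * w)%g.
Proof.
move=> hs e; rewrite /rhoK -scalerAl -scalerAr -fracmxM scalerA (rho_gen D) //.
rewrite (rho_desc D hs e) (ell_simple hs) expr1 e.
have Qx x : ('X^2)%:M * x = 'X^2 *: x :> 'M[B]_n.+1 by exact: mul_scalar_mx.
rewrite mulrBl !Qx mul1r /fracmx map_mxD map_mxB !map_mxZ.
rewrite scalerDr scalerBr !scalerA [in LHS]/= tofracXn; congr (_ + _ *: _).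
  rewrite -scalerBl; congr (_ *: _).
  rewrite laurent_eval_xi exprS.
  exact: quad_coef1 Xf_neq0 (Xfn_neq0 _).
rewrite exprS; exact: quad_coef2 Xf_neq0 (Xfn_neq0 _).
Qed.

Lemma fracmx_z w : rhoK w * fracmx z = fracmx z * rhoK w.
Proof.
rewrite /rhoK -scalerAl -scalerAr -!fracmxM; congr (_ *: fracmx _).
by rewrite (rho_comm D zc zm).
Qed.

Lemma trace_relation (I : Type) (r : seq I) (a : I -> laurent) (w : I -> extW) :
  commutators (\sum_(i <- r) a i *: T (w i)) ->
  \sum_(i <- r) laurent_eval (a i) *
    (Xf ^- ell (w i) * tofrac (\tr (rho c m (w i) * z))) = 0.
Proof.
move=> e.
have trD (x : vfrac) (A A' : 'M[vfrac]_n.+1) :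
    mxtrace (x *: A + A') = x * mxtrace A + mxtrace A'.
  by rewrite mxtraceD mxtraceZ.
have := trace_of_rep_relation HT (f := laurent_eval) rhoK1 rhoK_tau rhoK_asc
  rhoK_desc fracmx_z trD (@mxtrace_mulC _ _ _) e.
move=> e0; rewrite -[RHS]e0; apply: eq_bigr => i _; congr (_ * _).
rewrite /rhoK -scalerAl mxtraceZ -fracmxM; congr (_ * _).
by rewrite /fracmx trace_map_mx.
Qed.

End TraceFunctional.

(** * Linear independence from specialization at v = 1 *)

Lemma clear_denominators (R : fieldType) (P Q x y z : R) : y != 0 -> z != 0 ->
  P * x * Q = x * y * z * (P / y * (z^-1 * Q)).
Proof. by move=> y0 z0; field; rewrite y0 z0. Qed.

Section Independence.
Local Notation B := {poly zfrac}.
Local Notation tofrac := FracField.tofrac.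
Local Notation Xf := (tofrac ('X : B)).
Variables (I : eqType) (r : seq I) (w : I -> extW) (Phi : set (extW -> B)).

Hypothesis Phi_indep : forall c : I -> int,
  (forall phi, Phi phi -> \sum_(i <- r) (c i)%:~R * (phi (w i)).[1] = 0) ->
  forall i, i \in r -> c i = 0.

Lemma lift_poly_horner1 (p : {poly int}) : (lift_poly p).[1] = (p.[1])%:~R.
Proof. by rewrite /lift_poly -[1 in LHS](rmorph1 (intr : int -> zfrac)) horner_map. Qed.

Lemma lift_polyX1 : lift_poly ('X - 1%:P) = 'X - 1%:P.
Proof. by rewrite lift_polyB /lift_poly map_polyX map_polyC. Qed.

(* The specialized relation has integer coefficients, whence Phi_indep applies. *)
Lemma poly_relation_divX1 (p : I -> {poly int}) :
  (forall phi, Phi phi -> \sum_(i <- r) lift_poly (p i) * phi (w i) = 0) ->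
  exists g : I -> {poly int}, (forall i, i \in r -> p i = g i * ('X - 1%:P)) /\
    forall phi, Phi phi -> \sum_(i <- r) lift_poly (g i) * phi (w i) = 0.
Proof.
move=> hp.
have p1 i : i \in r -> (p i).[1] = 0.
  apply: (Phi_indep (c := fun i => (p i).[1])) => phi hphi.
  have := congr1 (horner^~ 1) (hp phi hphi); rewrite horner0 horner_sum => e.
  by rewrite -[RHS]e; apply: eq_bigr => j _; rewrite hornerM lift_poly_horner1.
have /choice[g gP] i : exists g : {poly int}, i \in r -> p i = g * ('X - 1%:P).
  case: (boolP (i \in r)) => [ir|_]; last by exists 0.
  by have /factor_theorem[g ->] : root (p i) 1 by [apply/rootP; exact: p1]; exists g.
exists g; split=> // phi hphi; apply/eqP.
have X1 : ('X - 1%:P : B) != 0 by rewrite polyXsubC_eq0.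
rewrite -(mulIr_eq0 _ (mulIf X1)) mulr_suml; apply/eqP.
rewrite -[RHS](hp phi hphi) !big_seq; apply: eq_bigr => i ir.
by rewrite (gP i ir) lift_polyM lift_polyX1 mulrAC.
Qed.

(** Repeated division shows that (v - 1)^k divides [p i] for every k; k = [size (p i)] exceeds the
    degree. *)
Lemma poly_relation_eq0 (p : I -> {poly int}) :
  (forall phi, Phi phi -> \sum_(i <- r) lift_poly (p i) * phi (w i) = 0) ->
  forall i, i \in r -> p i = 0.
Proof.
move=> hp i ir; apply/eqP; apply: contraT => pi0.
have div k : exists g : I -> {poly int},
    (forall i, i \in r -> p i = g i * ('X - 1%:P) ^+ k) /\
    forall phi, Phi phi -> \sum_(i <- r) lift_poly (g i) * phi (w i) = 0.
  elim: k => [|k [g [gp gs]]].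
    by exists p; split=> // j _; rewrite expr0 mulr1.
  have [g' [gg' gs']] := poly_relation_divX1 gs.
  by exists g'; split=> // j jr; rewrite exprS mulrA -gg' // gp.
have [g [/(_ i ir) gi _]] := div (size (p i)).
have g0 : g i != 0 by apply: contraNneq pi0 => g0; rewrite gi g0 mul0r.
have := congr1 (fun p : {poly int} => size p) gi.
rewrite size_Mmonic ?monic_exp ?monicXsubC // size_exp_XsubC => /eqP.
by rewrite addnS /= -[X in X == _]add0n eqn_add2r eq_sym size_poly_eq0 (negbTE g0).
Qed.

Lemma laurent_relation_eq0 (a : I -> laurent) :
  (forall phi, Phi phi -> \sum_(i <- r) laurent_eval (a i) *
     (Xf ^- ell (w i) * tofrac (phi (w i))) = 0) ->
  forall i, i \in r -> a i = 0.
Proof.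
move=> ha.
have /choice[pn pnP] i : exists pn : {poly int} * nat,
    val (a i) = tofrac pn.1 / tofrac 'X ^+ pn.2.
  by have [p [n e]] := laurent_exists (a i); exists (p, n).
(* The powers of v in the denominators come from the coefficient and from the normalization of the
   trace; v^N clears all of them at once. *)
pose d i := ((pn i).2 + ell (w i))%N.
pose N := (\sum_(i <- r) d i)%N.
have dN i : i \in r -> (d i <= N)%N.
  by move=> ir; rewrite /N (big_rem i) //= leq_addr.
pose p i := (pn i).1 * 'X^(N - d i).
have p0 : forall i, i \in r -> p i = 0.
  apply: poly_relation_eq0 => phi hphi.
  apply/eqP; rewrite -tofrac_eq tofrac0; apply/eqP.
  rewrite -[RHS](mulr0 (Xf ^+ N)) -[in RHS](ha phi hphi) mulr_sumr rmorph_sum /=.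
  rewrite !big_seq; apply: eq_bigr => i ir.
  rewrite (laurent_evalE (pnP i)) tofracM /p lift_polyM lift_polyXn tofracM tofracXn.
  have -> : Xf ^+ N = Xf ^+ (N - d i) * Xf ^+ (pn i).2 * Xf ^+ ell (w i).
    by rewrite -!exprD -addnA subnK // dN.
  exact: clear_denominators (Xfn_neq0 _) (Xfn_neq0 _).
move=> i /p0/eqP; rewrite mulf_eq0 expf_eq0 polyX_eq0 andbF orbF => /eqP e.
by apply: val_inj; rewrite /= pnP e tofrac0 mul0r.
Qed.

End Independence.

(** * Explicit representations and their characters at v = 1 *)

Section ExplicitReps.
Variable R : comNzRingType.
Implicit Types (q x y u t : R).

Definition fmx n (f : nat -> nat -> R) : 'M[R]_n := \matrix_(i < n, j < n) f i j.

Definition mul3 (f g : nat -> nat -> R) (i j : nat) : R :=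
  f i 0%N * g 0%N j + f i 1%N * g 1%N j + f i 2%N * g 2%N j.

Definition mul6 (f g : nat -> nat -> R) (i j : nat) : R :=
  f i 0%N * g 0%N j + f i 1%N * g 1%N j + f i 2%N * g 2%N j +
  f i 3%N * g 3%N j + f i 4%N * g 4%N j + f i 5%N * g 5%N j.

Lemma fmx3M f g : fmx 3 f * fmx 3 g = fmx 3 (mul3 f g).
Proof.
apply/matrixP => i j; rewrite !mxE 3!big_ord_recr big_ord0 /= add0r !mxE.
by [].
Qed.

Lemma fmx6M f g : fmx 6 f * fmx 6 g = fmx 6 (mul6 f g).
Proof.
apply/matrixP => i j; rewrite !mxE 6!big_ord_recr big_ord0 /= add0r !mxE.
by [].
Qed.

Lemma fmx3P f g :
  (forall i j, (i < 3)%N -> (j < 3)%N -> f i j = g i j) -> fmx 3 f = fmx 3 g.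
Proof. by move=> e; apply/matrixP => i j; rewrite !mxE e. Qed.

Lemma fmx6P f g :
  (forall i j, (i < 6)%N -> (j < 6)%N -> f i j = g i j) -> fmx 6 f = fmx 6 g.
Proof. by move=> e; apply/matrixP => i j; rewrite !mxE e. Qed.

Lemma fmxD n f g : fmx n f + fmx n g = fmx n (fun i j => f i j + g i j).
Proof. by apply/matrixP => i j; rewrite !mxE. Qed.

Lemma fmx_scalar n q : q%:M = fmx n (fun i j => if i == j then q else 0).
Proof. by apply/matrixP => i j; rewrite !mxE -val_eqE /=; case: eqP. Qed.

Lemma fmx_scalar_sub1 n q : (q%:M - 1 : 'M[R]_n.+1) =
  fmx n.+1 (fun i j => if i == j then q - 1 else 0).
Proof. by rewrite -fmx_scalar raddfB. Qed.

Definition cyc3 (i j : nat) : R :=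
  match i, j with 0, 1 | 1, 2 | 2, 0 => 1%R | _, _ => 0%R end%N.

(* Induced from the trivial representation of the Levi subalgebra of type A1;
   the basis is chosen so that tau acts as a cyclic permutation. *)
Definition ps3 q x x' (i j : nat) : R :=
  match i, j with
  | 0, 1 => x | 1, 0 => (q * x')%R | 1, 1 => (q - 1)%R | 2, 2 => q
  | _, _ => 0%R
  end%N.

Definition cyc6 (i j : nat) : R :=
  match i, j with
  | 0, 1 | 1, 2 | 2, 0 | 3, 4 | 4, 5 | 5, 3 => 1%R | _, _ => 0%R
  end%N.

(* The principal series: over q = 1 it is induced from the character of P that
   sends omega1 to x and s1 omega1 to y, in the basis e tau^j, e s1 tau^j (j < 3). *)
Definition ps6 q x x' y y' (i j : nat) : R :=
  match i, j with
  | 0, 0 => (q - 1)%R | 0, 3 => q | 1, 1 => (q - 1)%R | 1, 5 => (y' * q)%R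
  | 2, 4 => x | 3, 0 => 1%R | 4, 2 => (x' * q)%R | 4, 4 => (q - 1)%R
  | 5, 1 => y | _, _ => 0%R
  end%N.

Lemma scalar_mxC n q (u : 'M[R]_n.+1) : q%:M * u = u * q%:M.
Proof.
transitivity (q *: u); first exact: mul_scalar_mx.
exact: esym (mul_mx_scalar _ _).
Qed.

Lemma gen_s2 n (c m : 'M[R]_n.+1) : gen c m s2 = c * m * (c * c).
Proof. exact: gen2. Qed.

Lemma ps3_datum q x x' : x * x' = 1 ->
  Hecke_datum (fmx 3 cyc3) (fmx 3 (ps3 q x x')) q%:M.
Proof.
move=> xx; split.
- rewrite !fmx3M -[1]/(1%:M) fmx_scalar; apply: fmx3P.
  by case=> [|[|[|i]]] [|[|[|j]]] // _ _; rewrite /mul3 /=; ring.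
- rewrite fmx_scalar_sub1 fmx_scalar !fmx3M fmxD; apply: fmx3P.
  by case=> [|[|[|i]]] [|[|[|j]]] // _ _; rewrite /mul3 /=; ring: xx.
- rewrite gen_s2 !fmx3M; apply: fmx3P.
  by case=> [|[|[|i]]] [|[|[|j]]] // _ _; rewrite /mul3 /=; ring: xx.
- exact: scalar_mxC.
Qed.

Definition rot6 (i : nat) : nat :=
  match i with 0 => 1 | 1 => 2 | 2 => 0 | 3 => 4 | 4 => 5 | _ => 3 end%N.

Definition rot6V (i : nat) : nat :=
  match i with 0 => 2 | 1 => 0 | 2 => 1 | 3 => 5 | 4 => 3 | _ => 4 end%N.

Lemma cyc6M g : fmx 6 cyc6 * fmx 6 g = fmx 6 (fun i j => g (rot6 i) j).
Proof.
rewrite fmx6M; apply: fmx6P => i j + _; rewrite /mul6.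
by case: i => [|[|[|[|[|[|i]]]]]] //= _; ring.
Qed.

Lemma Mcyc6 g : fmx 6 g * fmx 6 cyc6 = fmx 6 (fun i j => g i (rot6V j)).
Proof.
rewrite fmx6M; apply: fmx6P => i j _; rewrite /mul6.
by case: j => [|[|[|[|[|[|j]]]]]] //= _; ring.
Qed.

Lemma cyc6_conj f : fmx 6 cyc6 * fmx 6 f * (fmx 6 cyc6 * fmx 6 cyc6) =
  fmx 6 (fun i j => f (rot6 i) (rot6 j)).
Proof.
rewrite mulrA cyc6M !Mcyc6; apply: fmx6P => i j _.
by case: j => [|[|[|[|[|[|j]]]]]].
Qed.

(** The rows of [ps6] have at most two non-zero entries and [cyc6] only reindexes, so products are
    formed row by row and the entries of the braid relation stay small. *)
Definition ps6_row q x x' y y' (v : nat -> R) (i : nat) : R :=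
  match i with
  | 0 => (q - 1) * v 0%N + q * v 3%N | 1 => (q - 1) * v 1%N + y' * q * v 5%N
  | 2 => x * v 4%N | 3 => v 0%N | 4 => x' * q * v 2%N + (q - 1) * v 4%N
  | _ => y * v 1%N
  end%R.

Lemma ps6M q x x' y y' g : fmx 6 (ps6 q x x' y y') * fmx 6 g =
  fmx 6 (fun i j => ps6_row q x x' y y' (g^~ j) i).
Proof.
rewrite fmx6M; apply: fmx6P => i j + _; rewrite /mul6.
by case: i => [|[|[|[|[|[|i]]]]]] //= _; ring.
Qed.

Lemma ps6_rotM q x x' y y' g :
  fmx 6 (fun i j => ps6 q x x' y y' (rot6 i) (rot6 j)) * fmx 6 g =
  fmx 6 (fun i j => ps6_row q x x' y y' (fun k => g (rot6V k) j) (rot6 i)).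
Proof.
rewrite fmx6M; apply: fmx6P => i j + _; rewrite /mul6.
by case: i => [|[|[|[|[|[|i]]]]]] //= _; ring.
Qed.

Lemma ps6_datum q x x' y y' : x * x' = 1 -> y * y' = 1 ->
  Hecke_datum (fmx 6 cyc6) (fmx 6 (ps6 q x x' y y')) q%:M.
Proof.
move=> xx yy; split.
- have := cyc6_conj (fun i j => if i == j then 1 else 0).
  rewrite -fmx_scalar -[1%:M]/(1 : 'M[R]_6) mulr1 => ->.
  transitivity (1%:M : 'M[R]_6) => //; rewrite fmx_scalar; apply: fmx6P.
  by case=> [|[|[|[|[|[|i]]]]]] [|[|[|[|[|[|j]]]]]].
- rewrite fmx_scalar_sub1 fmx_scalar ps6M fmx6M fmxD; apply: fmx6P => i j.
  rewrite /mul6; case: i => [|[|[|[|[|[|i]]]]]] //=;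
  by case: j => [|[|[|[|[|[|j]]]]]] //= _ _; ring: xx yy.
- rewrite gen_s2 cyc6_conj -!mulrA !(ps6M, ps6_rotM); apply: fmx6P.
  by case=> [|[|[|[|[|[|i]]]]]] [|[|[|[|[|[|j]]]]]] //= _ _; ring: xx yy.
- exact: scalar_mxC.
Qed.

(** The sum of the three twists of the index representation by the characters of Z/3, realized by a
    permutation matrix instead of cube roots of unity. *)
Lemma scalar_datum q : Hecke_datum (fmx 3 cyc3) (q%:M) (q%:M).
Proof.
have qC (u : 'M[R]_3) := scalar_mxC q u.
have cc : fmx 3 cyc3 * (fmx 3 cyc3 * fmx 3 cyc3) = 1.
  rewrite !fmx3M -[1]/(1%:M) fmx_scalar; apply: fmx3P.
  by case=> [|[|[|i]]] [|[|[|j]]] // _ _; rewrite /mul3 /=; ring.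
split=> //.
- by rewrite mulrBl mul1r subrK.
- by rewrite gen_s2 -qC -[q%:M * _ * _]mulrA cc mulr1.
Qed.

End ExplicitReps.

Section SpecialTraces.
Variable R : comNzRingType.
Implicit Types (x y : R).

Definition dg (u : nat -> R) (i j : nat) : R := if i == j then u i else 0.

Lemma dg3M u f : fmx 3 (dg u) * fmx 3 f = fmx 3 (fun i j => u i * f i j).
Proof.
rewrite fmx3M; apply: fmx3P => i j + _; rewrite /mul3 /dg.
by case: i => [|[|[|i]]] //= _; ring.
Qed.

Lemma dg6M u f : fmx 6 (dg u) * fmx 6 f = fmx 6 (fun i j => u i * f i j).
Proof.
rewrite fmx6M; apply: fmx6P => i j + _; rewrite /mul6 /dg.
by case: i => [|[|[|[|[|[|i]]]]]] //= _; ring.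
Qed.

Lemma dg1 n : fmx n.+1 (dg (fun=> 1)) = 1.
Proof. by rewrite /dg -fmx_scalar. Qed.

Lemma dg3X u k : fmx 3 (dg u) ^+ k = fmx 3 (dg (fun i => u i ^+ k)).
Proof.
elim: k => [|k IH]; first by rewrite expr0 -dg1.
rewrite exprS IH dg3M; apply: fmx3P => i j _ _; rewrite /dg.
by case: (i == j); rewrite ?mulr0 ?exprS.
Qed.

Lemma dg6X u k : fmx 6 (dg u) ^+ k = fmx 6 (dg (fun i => u i ^+ k)).
Proof.
elim: k => [|k IH]; first by rewrite expr0 -dg1.
rewrite exprS IH dg6M; apply: fmx6P => i j _ _; rewrite /dg.
by case: (i == j); rewrite ?mulr0 ?exprS.
Qed.

Lemma tr_fmx3 (f : nat -> nat -> R) : \tr (fmx 3 f) = f 0%N 0%N + f 1%N 1%N + f 2%N 2%N.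
Proof. by rewrite /mxtrace 3!big_ord_recr big_ord0 /= add0r !mxE. Qed.

Lemma tr_fmx6 (f : nat -> nat -> R) : \tr (fmx 6 f) = f 0%N 0%N + f 1%N 1%N + f 2%N 2%N
  + f 3%N 3%N + f 4%N 4%N + f 5%N 5%N.
Proof. by rewrite /mxtrace 6!big_ord_recr big_ord0 /= add0r !mxE. Qed.

Section Words.
Variables (n : nat) (c m : 'M[R]_n.+1).
Hypothesis D : Hecke_datum c m 1%:M.

Lemma rho1M a b : rho c m (a * b)%g = rho c m a * rho c m b.
Proof. exact: (rhoM D a b (erefl _)). Qed.

Lemma rho_s1E : rho c m s1 = m.
Proof. by rewrite (rho_gen D) ?gen1 // s1_simple. Qed.

Lemma rho_s2E : rho c m s2 = c * m * (c * c).
Proof. by rewrite (rho_gen D) ?gen_s2 // s2_simple. Qed.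

Lemma rho_transl1 : rho c m (mk 1 0 We) = c * (c * m * (c * c) * m).
Proof.
have -> : mk 1 0 We = (tau * (s2 * s1))%g by rewrite tau_mk s1_mk s2_mk !mkM.
by rewrite (rho1M tau) (rho1M s2) (rho_tau1 D) rho_s1E rho_s2E.
Qed.

Lemma rho_transl2 : rho c m (mk 0 1 We) = c * (c * (m * (c * m * (c * c)))).
Proof.
have -> : mk 0 1 We = (tau * (tau * (s1 * s2)))%g by rewrite tau_mk s1_mk s2_mk !mkM.
by rewrite (rho1M tau) (rho1M tau) (rho1M s1) (rho_tau1 D) rho_s1E rho_s2E.
Qed.

Lemma rho_transl1V : rho c m (mk (-1) 0 We) = m * (c * m * (c * c)) * (c * c).
Proof.
have -> : mk (-1) 0 We = (s1 * s2 * (tau * tau))%g by rewrite tau_mk s1_mk s2_mk !mkM.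
by rewrite (rho1M (s1 * s2)%g) (rho1M s1) (rho1M tau) (rho_tau1 D) rho_s1E rho_s2E.
Qed.

Lemma rho_translX (a b : nat) : rho c m (mk a%:Z b%:Z We) =
  rho c m (mk 1 0 We) ^+ a * rho c m (mk 0 1 We) ^+ b.
Proof.
elim: a => [|a IH].
  rewrite expr0 mul1r; elim: b => [|b IH]; first by rewrite expr0 -one_mk rho1.
  rewrite exprS -IH -rho1M mkM /=; congr (rho _ _ (mk _ _ _)); lia.
rewrite exprS -mulrA -IH -rho1M mkM /=; congr (rho _ _ (mk _ _ _)); lia.
Qed.

Lemma rho_translVX (a : nat) : rho c m (mk (- a%:Z) 0 We) =
  rho c m (mk (-1) 0 We) ^+ a.
Proof.
elim: a => [|a IH]; first by rewrite expr0 -(rho1 c m) one_mk; congr (rho _ _ (mk _ _ _)).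
rewrite exprS -IH -rho1M mkM /=; congr (rho _ _ (mk _ _ _)); lia.
Qed.

Lemma rho_transl_s1 k : rho c m (mk k 0 Wa) = rho c m (mk k 0 We) * m.
Proof.
transitivity (rho c m (mk k 0 We * s1)%g).
  by rewrite s1_mk mkM /=; congr (rho _ _ (mk _ _ _)); lia.
by rewrite (rho1M (mk k 0 We)) rho_s1E.
Qed.

Lemma rho_transl_s12 k : rho c m (mk k 0 Wab) =
  rho c m (mk k 0 We) * (m * (c * m * (c * c))).
Proof.
transitivity (rho c m (mk k 0 We * (s1 * s2))%g).
  by rewrite s1_mk s2_mk !mkM /=; congr (rho _ _ (mk _ _ _)); lia.
by rewrite (rho1M (mk k 0 We)) (rho1M s1) rho_s1E rho_s2E.
Qed.

Lemma tr_rho_conj (a b : extW) : conj_class a b ->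
  \tr (rho c m b) = \tr (rho c m a).
Proof.
case=> g _ <-; rewrite (rho1M (g * a)%g) mxtrace_mulC.
by rewrite -[_ *m _]/(_ * _) -rho1M mulgA mulVg mul1g.
Qed.

End Words.

Section PrincipalSeries.
Variables (x x' y y' : R).
Hypotheses (xx : x * x' = 1) (yy : y * y' = 1).
Local Notation c := (fmx 6 (@cyc6 R)).
Local Notation m := (fmx 6 (ps6 1 x x' y y')).
Local Notation D := (ps6_datum 1 xx yy).

(** The values at omega1 of the W-conjugates of the inducing character, each occurring twice. The
    orbit of omega1 sums to 0, whence the third value x' y'. *)
Definition wt_omega1 (i : nat) : R :=
  match i with
  | 0 => x | 1 => y | 2 => x' * y' | 3 => y | 4 => x | _ => x' * y'
  end%R.

Definition wt_omega1V (i : nat) : R :=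
  match i with
  | 0 => x' | 1 => y' | 2 => x * y | 3 => y' | 4 => x' | _ => x * y
  end%R.

Definition wt_omega2 (i : nat) : R :=
  match i with
  | 0 => x * y | 1 => x' | 2 => y' | 3 => x * y | 4 => y' | _ => x'
  end%R.

Lemma ps6_transl1 : rho c m (mk 1 0 We) = fmx 6 (dg wt_omega1).
Proof.
rewrite (rho_transl1 D) cyc6_conj ps6_rotM cyc6M; apply: fmx6P.
by case=> [|[|[|[|[|[|i]]]]]] [|[|[|[|[|[|j]]]]]] //= _ _; rewrite /dg /=; ring: xx yy.
Qed.

Lemma ps6_transl1V : rho c m (mk (-1) 0 We) = fmx 6 (dg wt_omega1V).
Proof.
rewrite (rho_transl1V D) cyc6_conj ps6M mulrA !Mcyc6; apply: fmx6P.
by case=> [|[|[|[|[|[|i]]]]]] [|[|[|[|[|[|j]]]]]] //= _ _; rewrite /dg /=; ring: xx yy.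
Qed.

Lemma ps6_transl2 : rho c m (mk 0 1 We) = fmx 6 (dg wt_omega2).
Proof.
rewrite (rho_transl2 D) cyc6_conj ps6M !cyc6M; apply: fmx6P.
by case=> [|[|[|[|[|[|i]]]]]] [|[|[|[|[|[|j]]]]]] //= _ _; rewrite /dg /=; ring: xx yy.
Qed.

Lemma ps6_diag (k : int) : exists u, rho c m (mk k 0 We) = fmx 6 (dg u).
Proof.
have [[a ->]|[a ->]] : (exists a : nat, k = a%:Z) \/ (exists a : nat, k = - a%:Z).
- by case: k => a; [left; exists a | right; exists a.+1].
- by rewrite (rho_translX D a 0) expr0 mulr1 ps6_transl1 dg6X; eexists.
- by rewrite (rho_translVX D) ps6_transl1V dg6X; eexists.
Qed.

Lemma tr_ps6_transl (a b : nat) : \tr (rho c m (mk a%:Z b%:Z We)) =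
  \sum_(i < 6) wt_omega1 i ^+ a * wt_omega2 i ^+ b.
Proof.
rewrite (rho_translX D) ps6_transl1 ps6_transl2 !dg6X dg6M tr_fmx6.
by rewrite 6!big_ord_recr big_ord0 /= add0r /dg /=.
Qed.

(** Translations act diagonally, and at q = 1 the matrix of s1 has zero diagonal. *)
Lemma tr_ps6_refl k : \tr (rho c m (mk k 0 Wa)) = 0.
Proof.
have [u e] := ps6_diag k; rewrite (rho_transl_s1 D) e dg6M tr_fmx6 /=.
by rewrite subrr !mulr0 !addr0.
Qed.

Lemma tr_ps6_cox k : \tr (rho c m (mk k 0 Wab)) = 0.
Proof.
have [u e] := ps6_diag k.
rewrite (rho_transl_s12 D) e cyc6_conj ps6M dg6M tr_fmx6 /=.
by ring.
Qed.

End PrincipalSeries.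

Section InducedTrivial.
Variables (x x' : R).
Hypothesis xx : x * x' = 1.
Local Notation c := (fmx 3 (@cyc3 R)).
Local Notation m := (fmx 3 (ps3 1 x x')).
Local Notation D := (ps3_datum 1 xx).

Definition wt3 (i : nat) : R := if i == 1%N then x * x else x'.
Definition wt3V (i : nat) : R := if i == 1%N then x' * x' else x.

Lemma ps3_transl1 : rho c m (mk 1 0 We) = fmx 3 (dg wt3).
Proof.
rewrite (rho_transl1 D) !fmx3M; apply: fmx3P.
by case=> [|[|[|i]]] [|[|[|j]]] //= _ _; rewrite /dg /wt3 /mul3 /=; ring: xx.
Qed.

Lemma ps3_transl1V : rho c m (mk (-1) 0 We) = fmx 3 (dg wt3V).
Proof.
rewrite (rho_transl1V D) !fmx3M; apply: fmx3P.
by case=> [|[|[|i]]] [|[|[|j]]] //= _ _; rewrite /dg /wt3V /mul3 /=; ring: xx.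
Qed.

(** Only the last basis line is stable under s1, and t^omega1 acts on it by x'; for generic x' the
    power determines a. *)
Lemma tr_ps3_refl (a : nat) : \tr (rho c m (mk a%:Z 0 Wa)) = x' ^+ a.
Proof.
rewrite (rho_transl_s1 D) (rho_translX D a 0) expr0 mulr1 ps3_transl1 dg3X.
by rewrite dg3M tr_fmx3 /= /wt3 /=; ring.
Qed.

Lemma tr_ps3_reflV (a : nat) : \tr (rho c m (mk (- a%:Z) 0 Wa)) = x ^+ a.
Proof.
rewrite (rho_transl_s1 D) (rho_translVX D) ps3_transl1V dg3X.
by rewrite dg3M tr_fmx3 /= /wt3V /=; ring.
Qed.

Lemma tr_ps3_cox (a : nat) : \tr (rho c m (mk a%:Z 0 Wab)) = 0.
Proof.
rewrite (rho_transl_s12 D) (rho_translX D a 0) expr0 mulr1 ps3_transl1 dg3X.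
by rewrite !fmx3M tr_fmx3 /mul3 /dg /wt3 /=; ring.
Qed.

End InducedTrivial.

(** With the simple reflections acting trivially, t^(a omega1) s1 s2 acts as c^a, and c^(a + b) has
    trace 3 or 0 according to whether 3 divides a + b. *)
Lemma tr_scalar_cox (a b : nat) : (a < 3)%N -> (b < 3)%N ->
  \tr (rho (fmx 3 (@cyc3 R)) 1%:M (mk a%:Z 0 Wab) * fmx 3 (@cyc3 R) ^+ b) =
  if (a + b == 0)%N || (a + b == 3)%N then 3%:R else 0.
Proof.
move=> a3 b3; have D := scalar_datum (1 : R).
have cc : fmx 3 (@cyc3 R) * (fmx 3 (@cyc3 R) * fmx 3 (@cyc3 R)) = 1.
  exact: datum_c3 D.
rewrite (rho_transl_s12 D) (rho_translX D a 0) expr0 mulr1 (rho_transl1 D).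
rewrite -[1%:M]/(1 : 'M[R]_3) !mulr1 mul1r cc !mulr1.
rewrite -exprD.
have : (a + b < 5)%N by lia.
have t0 : \tr (fmx 3 (@cyc3 R)) = 0 by rewrite tr_fmx3 /= !addr0.
have t1 : \tr (1 : 'M[R]_3) = 3%:R by rewrite mxtrace1.
have t2 : \tr (fmx 3 (@cyc3 R) * fmx 3 (@cyc3 R)) = 0.
  by rewrite fmx3M tr_fmx3 /mul3 /=; ring.
by case: (a + b)%N => [|[|[|[|[|d]]]]] //= _;
  rewrite !exprS expr0 mulr1 ?cc ?mulr1 ?t2.
Qed.

End SpecialTraces.

(** * The family of traces with generic parameter z *)

Section TraceFamily.
Local Notation B := {poly zfrac}.
Local Notation tofrac := FracField.tofrac.
Local Notation zv := (tofrac ('X : {poly int})).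

Lemma zv_neq0 : zv != 0.
Proof. by rewrite tofrac_eq0 polyX_eq0. Qed.

(** As z is transcendental, the coefficients of each power z^E can be compared. *)
Lemma zpow_coef (I : eqType) (r : seq I) (c : I -> int) (L : I -> seq int) :
  \sum_(i <- r) (c i)%:~R * (\sum_(e <- L i) zv ^ e) = 0 ->
  forall E, \sum_(i <- r) c i * (count_mem E (L i))%:Z = 0.
Proof.
(* K bounds the absolute values of all exponents, so multiplication by z^K brings the relation into
   Z[z]. *)
move=> h E; pose K := (\sum_(i <- r) \sum_(e <- L i) absz e + absz E)%N.
have KL i e : i \in r -> e \in L i -> 0 <= K%:Z + e.
  move=> ir eL; have : (absz e <= K)%N.
    rewrite /K (big_rem i) //= (big_rem e) //= -!addnA leq_addr //.
  by lia.
have KE : 0 <= K%:Z + E by rewrite /K; lia.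
pose P := \sum_(i <- r) (c i)%:P * (\sum_(e <- L i) 'X^(absz (K%:Z + e))).
have P0 : P = 0.
  apply/eqP; rewrite -tofrac_eq tofrac0; apply/eqP.
  rewrite -[RHS](mulr0 (zv ^+ K)) -[in RHS]h mulr_sumr rmorph_sum /= !big_seq.
  apply: eq_bigr => i ir; rewrite tofracM mulrCA; congr (_ * _).
    by rewrite -[in LHS](intz (c i)) rmorph_int rmorph_int.
  rewrite mulr_sumr rmorph_sum /= !big_seq; apply: eq_bigr => e eL.
  rewrite tofracXn !exprnP -expfzDr ?zv_neq0 //.
  by congr (_ ^ _); have := KL i e ir eL; lia.
have := congr1 (fun p : {poly int} => p`_(absz (K%:Z + E))) P0.
rewrite coef0 /P coef_sum => e0; rewrite -[RHS]e0 !big_seq.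
apply: eq_bigr => i ir; rewrite coefCM; congr (_ * _).
have := KL i ^~ ir; elim: (L i) => [|e s IH] sK; first by rewrite big_nil coef0.
rewrite big_cons coefD coefXn /= -IH => [|e' e's]; last first.
  by apply: sK; rewrite inE e's orbT.
rewrite PoszD; congr (_ + _).
have := sK e (mem_head _ _); case: (eqVneq e E) => [->|ne] he.
  by rewrite eqxx.
by case: eqP => // ?; case/eqP: ne; lia.
Qed.

(** The parameters x = z^N and y = z come from a single indeterminate; taking N large makes them
    behave as independent ones on a given finite set of classes. *)
Definition phi6 (N : nat) (w : extW) : B :=
  \tr (rho (fmx 6 (@cyc6 B))
    (fmx 6 (ps6 'X^2 (zv ^+ N)%:P (zv ^- N)%:P zv%:P (zv^-1)%:P)) w * 1).

Definition phi3 (w : extW) : B :=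
  \tr (rho (fmx 3 (@cyc3 B)) (fmx 3 (ps3 'X^2 zv%:P (zv^-1)%:P)) w * 1).

Definition phi1 (b : nat) (w : extW) : B :=
  \tr (rho (fmx 3 (@cyc3 B)) ('X^2)%:M w * fmx 3 (@cyc3 B) ^+ b).

Definition trace_family : set (extW -> B) :=
  [set phi | [\/ exists N, phi = phi6 N, phi = phi3 | exists b, phi = phi1 b]].

Lemma polyC_inv (u : zfrac) : u != 0 -> u%:P * (u^-1)%:P = 1 :> B.
Proof. by move=> u0; rewrite -polyCM divff. Qed.

Lemma trace_family_relation (H : algType laurent) (T : extW -> H)
    (HT : Hecke_basis T) (I : Type) (r : seq I) (a : I -> laurent)
    (w : I -> extW) phi : trace_family phi ->
  commutators (\sum_(i <- r) a i *: T (w i)) ->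
  \sum_(i <- r) laurent_eval (a i) *
    (tofrac ('X : B) ^- ell (w i) * tofrac (phi (w i))) = 0.
Proof.
have zN0 N : zv ^+ N != 0 by rewrite expf_neq0 // zv_neq0.
case=> [[N ->]|->|[b ->]] e.
- apply: (trace_relation HT (ps6_datum _ (polyC_inv (zN0 N)) (polyC_inv zv_neq0)) _ _ e).
    by rewrite mul1r mulr1.
  by rewrite mul1r mulr1.
- apply: (trace_relation HT (ps3_datum _ (polyC_inv zv_neq0)) _ _ e).
    by rewrite mul1r mulr1.
  by rewrite mul1r mulr1.
- apply: (trace_relation HT (scalar_datum _) _ _ e).
    by rewrite -exprSr -exprS.
  exact: esym (scalar_mxC _ _).
Qed.

Lemma horner_tr n (c m z : 'M[B]_n.+1) w :
  (\tr (rho c m w * z)).[1] = \tr (rho (map_mx (horner_eval 1) c)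
    (map_mx (horner_eval 1) m) w * map_mx (horner_eval 1) z).
Proof.
rewrite -(rho_map (map_mx (horner_eval 1))) -rmorphM.
by rewrite -[LHS]/(horner_eval 1 _) -trace_map_mx.
Qed.

Lemma phi6_1 N w : (phi6 N w).[1] = \tr (rho (fmx 6 (@cyc6 zfrac))
  (fmx 6 (ps6 1 (zv ^+ N) (zv ^- N) zv zv^-1)) w).
Proof.
have cE : map_mx (horner_eval 1) (fmx 6 (@cyc6 B)) = fmx 6 (@cyc6 zfrac).
  apply/matrixP => i j; rewrite !mxE /horner_eval.
  by case: i j => [[|[|[|[|[|[|i]]]]]] hi] [[|[|[|[|[|[|j]]]]]] hj] //=;
    rewrite ?hornerC.
have mE : map_mx (horner_eval 1) (fmx 6
      (ps6 'X^2 (zv ^+ N)%:P (zv ^- N)%:P zv%:P (zv^-1)%:P)) =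
    fmx 6 (ps6 1 (zv ^+ N) (zv ^- N) zv zv^-1).
  apply/matrixP => i j; rewrite !mxE /horner_eval.
  by case: i j => [[|[|[|[|[|[|i]]]]]] hi] [[|[|[|[|[|[|j]]]]]] hj] //=;
    rewrite !hornerE ?expr1n /= ?mulr1.
by rewrite /phi6 horner_tr cE mE (map_mx1 (horner_eval 1)) mulr1.
Qed.

Lemma phi3_1 w : (phi3 w).[1] = \tr (rho (fmx 3 (@cyc3 zfrac))
  (fmx 3 (ps3 1 zv zv^-1)) w).
Proof.
have cE : map_mx (horner_eval 1) (fmx 3 (@cyc3 B)) = fmx 3 (@cyc3 zfrac).
  apply/matrixP => i j; rewrite !mxE /horner_eval.
  by case: i j => [[|[|[|i]]] hi] [[|[|[|j]]] hj] //=; rewrite ?hornerC.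
have mE : map_mx (horner_eval 1) (fmx 3 (ps3 'X^2 zv%:P (zv^-1)%:P)) =
    fmx 3 (ps3 1 zv zv^-1).
  apply/matrixP => i j; rewrite !mxE /horner_eval.
  by case: i j => [[|[|[|i]]] hi] [[|[|[|j]]] hj] //=;
    rewrite !hornerE ?expr1n /= ?mulr1 ?mul1r.
by rewrite /phi3 horner_tr cE mE (map_mx1 (horner_eval 1)) mulr1.
Qed.

Lemma phi1_1 b w : (phi1 b w).[1] = \tr (rho (fmx 3 (@cyc3 zfrac)) 1%:M w
  * fmx 3 (@cyc3 zfrac) ^+ b).
Proof.
have cE : map_mx (horner_eval 1) (fmx 3 (@cyc3 B)) = fmx 3 (@cyc3 zfrac).
  apply/matrixP => i j; rewrite !mxE /horner_eval.
  by case: i j => [[|[|[|i]]] hi] [[|[|[|j]]] hj] //=; rewrite ?hornerC.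
have mE : map_mx (horner_eval 1) (('X^2)%:M : 'M[B]_3) = 1%:M.
  apply/matrixP => i j; rewrite !mxE /horner_eval.
  by case: (i == j); rewrite ?mulr1n ?mulr0n !hornerE ?expr1n.
have XE : map_mx (horner_eval 1) (fmx 3 (@cyc3 B) ^+ b) = fmx 3 (@cyc3 zfrac) ^+ b.
  by rewrite -cE; elim: b => [|k IH]; rewrite ?expr0 ?map_mx1 // !exprS map_mxM IH.
by rewrite /phi1 horner_tr cE mE XE.
Qed.

End TraceFamily.

(** * Separation of the conjugacy classes at v = 1 *)

Section NormalFormIndependence.
Local Notation tofrac := FracField.tofrac.
Local Notation zv := (tofrac ('X : {poly int})).

Lemma seq_argmax (I : eqType) (s : seq I) (f : I -> nat) x0 : x0 \in s ->
  exists2 x, x \in s & forall y, y \in s -> (f y <= f x)%N.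
Proof.
elim: s x0 => // a [|b s] IH x0 _.
  by exists a; rewrite ?mem_head // => y; rewrite inE => /eqP->.
have [x xs xmax] := IH b (mem_head _ _).
have [le|lt] := leqP (f x) (f a).
  exists a; first exact: mem_head.
  move=> y; rewrite inE => /orP[/eqP->//|/xmax h]; exact: leq_trans h le.
exists x; first by rewrite inE xs orbT.
by move=> y; rewrite inE => /orP[/eqP->|/xmax//]; exact: ltnW.
Qed.

(* phi6 N specializes at v = 1 to the sum over w in W of z^(<w l, rho_N>), where
   l |-> <l, rho_N> = N l_1 + (N + 1) l_2 is regular dominant, and injective on
   the dominant (l_1, l_2) with l_2 < N. *)
Definition exps6 (N : nat) (k : nf) : seq int :=
  if k is inl (a, b) then
    [:: (N * a + N.+1 * b)%N%:Z; a%:Z - (N * b)%N%:Z;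
        - (N.+1 * a + b)%N%:Z; (a + N.+1 * b)%N%:Z; (N * a)%N%:Z - b%:Z;
        - (N.+1 * a + N * b)%N%:Z]
  else [::].

Definition exps3 (k : nf) : seq int :=
  if k is inr (inl n) then [:: - n] else [::].

Definition exps1 (b : nat) (k : nf) : seq int :=
  if k is inr (inr j) then
    if (j + b == 0)%N || (j + b == 3)%N then [:: 0; 0; 0] else [::]
  else [::].

Lemma zv_exp_opp (m : nat) : zv ^- m = zv ^ (- m%:Z).
Proof. exact: exprnN. Qed.

Lemma zv_exp_sub (m p : nat) : zv ^+ m * zv ^- p = zv ^ (m%:Z - p%:Z).
Proof. by rewrite expfzDr ?zv_neq0 // zv_exp_opp -exprnP. Qed.

Lemma phi6_nf N k : (phi6 N (nf_elt k)).[1] = \sum_(e <- exps6 N k) zv ^ e.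
Proof.
have xx : zv ^+ N * zv ^- N = 1 by rewrite divff // expf_neq0 // zv_neq0.
have yy : zv * zv^-1 = 1 by rewrite divff // zv_neq0.
rewrite phi6_1; case: k => [[a b]|[n|j]] /=.
- rewrite (tr_ps6_transl xx yy) 6!big_ord_recl big_ord0 !big_cons big_nil /=.
  have VV : zv ^- N * zv^-1 = zv ^- N.+1 by rewrite exprSr invfM mulrC.
  rewrite VV -exprSr; congr (_ + (_ + (_ + (_ + (_ + (_ + _)))))).
  + by rewrite -!exprM -exprD.
  + by rewrite exprVn -exprM zv_exp_sub.
  + by rewrite !exprVn -!exprM -invfM -exprD zv_exp_opp addnC.
  + by rewrite -!exprM -exprD.
  + by rewrite exprVn -exprM zv_exp_sub.
  + by rewrite !exprVn -!exprM -invfM -exprD zv_exp_opp addnC.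
- by rewrite (tr_ps6_refl xx yy) big_nil.
- by rewrite (tr_ps6_cox xx yy) big_nil.
Qed.

Lemma phi3_nf (k : int + 'I_3) :
  (phi3 (nf_elt (inr k))).[1] = \sum_(e <- exps3 (inr k)) zv ^ e.
Proof.
have yy : zv * zv^-1 = 1 by rewrite divff // zv_neq0.
rewrite phi3_1; case: k => [n|j] /=.
  rewrite big_seq1.
  have [[a ->]|[a ->]] : (exists a : nat, n = a%:Z) \/ (exists a : nat, n = - a%:Z).
  - by case: n => a; [left; exists a | right; exists a.+1].
  - by rewrite (tr_ps3_refl yy) exprVn zv_exp_opp.
  - by rewrite (tr_ps3_reflV yy) opprK.
by rewrite (tr_ps3_cox yy) big_nil.
Qed.

Lemma phi1_nf b (j : 'I_3) : (b < 3)%N ->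
  (phi1 b (nf_elt (inr (inr j)))).[1] = \sum_(e <- exps1 b (inr (inr j))) zv ^ e.
Proof.
move=> b3; rewrite phi1_1 /= tr_scalar_cox ?ltn_ord //.
case: ifP => _; last by rewrite big_nil.
by rewrite !big_cons big_nil !expr0z -natr1 -natr1 /= addr0 addrA.
Qed.

(** At v = 1 the representations are multiplicative on the group, so these traces are class
    functions. *)
Lemma phi_conj phi x y : trace_family phi -> conj_class x y ->
  (phi y).[1] = (phi x).[1].
Proof.
have xx N : zv ^+ N * zv ^- N = 1 by rewrite divff // expf_neq0 // zv_neq0.
have yy : zv * zv^-1 = 1 by rewrite divff // zv_neq0.
case=> [[N ->]|->|[b ->]] xy.
- by rewrite !phi6_1; apply: (tr_rho_conj (ps6_datum 1 (xx N) yy)).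
- by rewrite !phi3_1; apply: (tr_rho_conj (ps3_datum 1 yy)).
- have D := scalar_datum (1 : zfrac).
  rewrite !phi1_1; case: xy => g _ <-; rewrite (rho1M D (g * x)%g).
  have zC w : fmx 3 (@cyc3 zfrac) ^+ b * rho (fmx 3 (@cyc3 zfrac)) 1%:M w =
      rho (fmx 3 (@cyc3 zfrac)) 1%:M w * fmx 3 (@cyc3 zfrac) ^+ b.
    apply: (rho_comm D); first by rewrite -exprSr -exprS.
    exact: esym (scalar_mxC _ _).
  have tC (u v : 'M[zfrac]_3) : \tr (u * v) = \tr (v * u) by exact: mxtrace_mulC.
  by rewrite -mulrA tC -mulrA zC mulrA -(rho1M D) mulgA mulVg mul1g.
Qed.

Variables (r : seq nf) (w : nf -> extW) (c : nf -> int).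
Hypotheses (r_uniq : uniq r) (w_class : forall k, nf_class k (w k))
  (c_rel : forall phi, trace_family phi ->
     \sum_(k <- r) (c k)%:~R * (phi (w k)).[1] = 0).

Lemma exps_relation phi (L : nf -> seq int) : trace_family phi ->
  (forall k, k \in r -> c k != 0 ->
     (phi (nf_elt k)).[1] = \sum_(e <- L k) zv ^ e) ->
  forall E, \sum_(k <- r) c k * (count_mem E (L k))%:Z = 0.
Proof.
move=> hphi phiL; apply: zpow_coef; rewrite -[RHS](c_rel hphi) !big_seq.
apply: eq_bigr => k kr; have [->|ck] := eqVneq (c k) 0; first by rewrite !mul0r.
by rewrite -phiL // (phi_conj hphi (w_class k)).
Qed.

(** The coefficient of z^E in the relation is then [c k0] times a positive multiplicity. *)
Lemma isolated_exp (L : nf -> seq int) E k0 : k0 \in r -> E \in L k0 ->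
  \sum_(k <- r) c k * (count_mem E (L k))%:Z = 0 ->
  (forall k, k \in r -> c k != 0 -> E \in L k -> k = k0) -> c k0 = 0.
Proof.
move=> k0r EL e only; move: e; rewrite (bigD1_seq k0) //= big1_seq ?addr0.
  move/eqP; rewrite mulf_eq0 => /orP[/eqP//|/eqP[e0]].
  by move: EL; rewrite -has_pred1 has_count e0.
move=> k /andP[kk0 kr]; have [->|ck] := eqVneq (c k) 0; first by rewrite mul0r.
have /count_memPn -> : E \notin L k by apply: contra kk0 => /only->.
by rewrite mulr0.
Qed.

Lemma coef_transl_eq0 a b : inl (a, b) \in r -> c (inl (a, b)) = 0.
Proof.
move=> kr; apply/eqP; apply: contraT => ck.
pose B (k : nf) := (if k is inl (a, b) then b else 0)%N.
(* N exceeds every b in the relation, so a + b and b are quotient and remainder by N of the leading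
   exponent N a + (N + 1) b = N (a + b) + b. Below, [f] is this exponent, and a term of the support
   that maximizes it will be isolated. *)
pose N := (\sum_(k <- r) B k).+1.
have BN k : k \in r -> (B k < N)%N by move=> h; rewrite ltnS (big_rem k) //= leq_addr.
pose f (k : nf) := (if k is inl (a, b) then N * (a + b) + b else 0)%N.
pose s := [seq k <- r | (c k != 0) && (if k is inl _ then true else false)].
have ks : inl (a, b) \in s by rewrite mem_filter ck kr.
have [[[a0 b0]|k]] := seq_argmax f ks; rewrite mem_filter ?andbF //.
move=> /andP[/andP[c0 _] r0] fmax.
have c00 : c (inl (a0, b0)) = 0; last by rewrite c00 eqxx in c0.
have hphi : trace_family (phi6 N) by apply: Or31; exists N.
apply: (isolated_exp (L := exps6 N) (E := (N * a0 + N.+1 * b0)%N%:Z) r0).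
- exact: mem_head.
- by apply: (exps_relation hphi) => k _ _; apply: phi6_nf.
case=> [[a1 b1]|//] r1 c1.
have /fmax : inl (a1, b1) \in s by rewrite mem_filter c1 r1.
have := BN _ r0; have := BN _ r1; rewrite /f /B => lt1 lt0 le10.
have le : (N * a1 + N.+1 * b1 <= N * a0 + N.+1 * b0)%N.
  by move: le10; rewrite !mulnDr !mulSn; lia.
have le2 : (b1 <= N * b1)%N by rewrite leq_pmull.
have le3 : (a1 <= N * a1)%N by rewrite leq_pmull.
have eqE : (N * a1 + N.+1 * b1 = N * a0 + N.+1 * b0)%N ->
    inl (a1, b1) = inl (a0, b0) :> nf.
  have e x y : (N * x + N.+1 * y = (x + y) * N + y)%N.
    by rewrite mulSn mulnDl mulnC (mulnC y); lia.
  rewrite !e => e1; have b10 : b1 = b0.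
    by have := congr1 (modn^~ N) e1; rewrite !modnMDl !modn_small.
  by move/eqP: e1; rewrite b10 eqn_add2r eqn_pmul2r // eqn_add2r => /eqP->.
(* Each exponent of (a1, b1) is at most its leading one, which is at most E by maximality; if one of
   them equals E, the leading exponents agree and [eqE] applies. *)
rewrite !inE => /or4P[/eqP e|/eqP e|/eqP e|].
- by apply: eqE; lia.
- by apply: eqE; rewrite mulSn; rewrite !mulSn in le e; lia.
- by apply: eqE; rewrite mulSn; rewrite !mulSn in le e; lia.
move=> /or3P[/eqP e|/eqP e|/eqP e].
- by apply: eqE; rewrite mulSn; rewrite !mulSn in le e; lia.
- by apply: eqE; rewrite mulSn; rewrite !mulSn in le e; lia.
- by apply: eqE; rewrite mulSn; rewrite !mulSn in le e; lia.
Qed.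

(** The trace [phi3] need not vanish on translations, but their coefficients are already known to be
    0. What remains are the exponents -n, distinct for distinct n. *)
Lemma coef_refl_eq0 n : inr (inl n) \in r -> c (inr (inl n)) = 0.
Proof.
move=> kr; have hphi : trace_family phi3 by apply: Or32.
apply: (isolated_exp (L := exps3) (E := - n) kr); first exact: mem_head.
  apply: (exps_relation hphi) => -[[a b]|k] rk ck; last exact: phi3_nf.
  by rewrite coef_transl_eq0 ?eqxx in ck.
by case=> [//|[m|//]] _ _; rewrite inE => /eqP/oppr_inj->.
Qed.

Lemma coef_cox_eq0 j : inr (inr j) \in r -> c (inr (inr j)) = 0.
Proof.
(* This b is -j modulo 3, so among the three Coxeter classes only j has a non-zero trace. *)
move=> kr; pose b := ((3 - j) %% 3)%N.
have b3 : (b < 3)%N by apply: ltn_pmod.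
have jb k : (k < 3)%N -> (k + b == 0)%N || (k + b == 3)%N = (k == j)%N.
  by have := ltn_ord j; rewrite /b; case: (nat_of_ord j) => [|[|[|]]] // _;
     case: k => [|[|[|]]].
have hphi : trace_family (phi1 b) by apply: Or33; exists b.
apply: (isolated_exp (L := exps1 b) (E := 0) kr).
- by rewrite /= jb ?ltn_ord // eqxx.
- apply: (exps_relation hphi) => -[[a' b']|[n|i]] rk ck; last exact: phi1_nf.
    by rewrite coef_transl_eq0 ?eqxx in ck.
  by rewrite coef_refl_eq0 ?eqxx in ck.
case=> [//|[//|i]] _ _; rewrite /= jb ?ltn_ord //.
by case: eqP => // e _; congr (inr (inr _)); apply: val_inj.
Qed.

Lemma nf_indep k : k \in r -> c k = 0.
Proof.
case: k => [[a b]|[n|j]].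
- exact: coef_transl_eq0.
- exact: coef_refl_eq0.
- exact: coef_cox_eq0.
Qed.

End NormalFormIndependence.

(** Each [w k] may be any element of its class, since at v = 1 only the class enters. *)
Lemma cocenter_indep (H : algType laurent) (T : extW -> H) (HT : Hecke_basis T)
    (r : seq nf) (w : nf -> extW) (a : nf -> laurent) :
  uniq r -> (forall k, nf_class k (w k)) ->
  commutators (\sum_(k <- r) a k *: T (w k)) ->
  forall k, k \in r -> a k = 0.
Proof.
move=> ur hw ha; apply: (@laurent_relation_eq0 _ r w trace_family).
  by move=> c hc k; apply: (nf_indep ur hw hc).
by move=> phi hphi; apply: (trace_family_relation HT hphi ha).
Qed.

Lemma min_length_exists O : conj_classes O -> exists x, min_length_in O x.
Proof.
case=> g _ <-.
have ex : exists n, `[< exists2 x, conj_class g x & length x = n >].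
  by exists (length g); apply/asboolP; exists g => //; apply: conj_class_refl.
case: (ex_minnP ex) => n /asboolP[x gx <-] xmin; exists x; split=> // y gy.
by apply: xmin; apply/asboolP; exists y.
Qed.

Definition coef_of (e : seq (laurent * nf)) (O : set extW) : laurent :=
  \sum_(p <- e | `[< O = nf_class p.2 >]) p.1.

Lemma coef_of_nf e k : coef_of e (nf_class k) = \sum_(p <- e | p.2 == k) p.1.
Proof.
apply: eq_bigl => p; apply/asboolP/eqP => [/nf_class_inj->//|->//].
Qed.

Lemma coef_of_notin e k : k \notin [seq p.2 | p <- e] ->
  coef_of e (nf_class k) = 0.
Proof.
move=> ke; rewrite coef_of_nf big_seq_cond big1 // => p /andP[pe /eqP pk].
by case/negP: ke; rewrite -pk map_f.
Qed.

Lemma coef_of_in e a k : uniq [seq p.2 | p <- e] -> (a, k) \in e ->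
  coef_of e (nf_class k) = a.
Proof.
rewrite coef_of_nf; elim: e => //= -[b j] e IH /= /andP[je ue].
rewrite inE big_cons /= => /orP[/eqP[-> ->]|ke].
  rewrite eqxx big_seq_cond big1 ?addr0 // => p /andP[pe /eqP pk].
  by case/negP: je; rewrite -pk map_f.
case: eqP => [jk|_]; last exact: IH.
by case/negP: je; rewrite jk; have := map_f snd ke.
Qed.

(** * Class polynomials *)

Section ClassPolynomials.
Variables (H : algType laurent) (T : extW -> H) (HT : Hecke_basis T).

Lemma class_coefs_uniq w f g :
  class_coefs T w f -> class_coefs T w g -> f = g.
Proof.
move=> [f0 ffin fm] [g0 gfin gm].
(* Both expansions are compared on one family of representatives. *)
have /choice[m mP] O : exists x, conj_classes O -> min_length_in O x.
  have [/min_length_exists[x]|nO] := pselect (conj_classes O); first by exists x.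
  by exists 1%g.
have [r1 e1] := (finite_seqP _).1 ffin; have [r2 e2] := (finite_seqP _).1 gfin.
have /choice[nfO nfOP] O : exists k, conj_classes O -> O = nf_class k.
  have [/conj_classesP[k ->]|nO] := pselect (conj_classes O); first by exists k.
  by exists nf_cox.
have nfOK k : nfO (nf_class k) = k.
  by apply: nf_class_inj; rewrite -nfOP //; apply: nf_conj_class.
pose s : seq nf := undup (map nfO (r1 ++ r2)).
have fs k : f (nf_class k) != 0 -> k \in s.
  move=> fk; rewrite mem_undup -[k]nfOK map_f // mem_cat.
  have : [set O | f O != 0] (nf_class k) by [].
  by rewrite e1 => ->.
have gs k : g (nf_class k) != 0 -> k \in s.
  move=> gk; rewrite mem_undup -[k]nfOK map_f // mem_cat.
  have : [set O | g O != 0] (nf_class k) by [].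
  by rewrite e2 => ->; rewrite orbT.
have us : uniq s by apply: undup_uniq.
have sumE h : (forall k, h (nf_class k) != 0 -> k \in s) ->
    \sum_(O \in conj_classes) h O *: T (m O) =
    \sum_(k <- s) h (nf_class k) *: T (m (nf_class k)).
  move=> hs; rewrite (@fsum_seq _ _ _ (map nf_class s)) ?big_map //.
  - by rewrite map_inj_uniq //; apply: nf_class_inj.
  - by move=> O /mapP[k _ ->]; apply: nf_conj_class.
  - move=> O /conj_classesP[k ->]; rewrite mem_map; last exact: nf_class_inj.
    move=> ks; have -> : h (nf_class k) = 0; last by rewrite scale0r.
    by apply/eqP; apply: contraNT ks; apply: hs.
have rel : commutators (\sum_(k <- s) (f (nf_class k) - g (nf_class k)) *:
    T (m (nf_class k))).
  have := comm_equiv_trans (comm_equiv_sym (fm m mP)) (gm m mP).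
  rewrite (sumE _ fs) (sumE _ gs) /comm_equiv -sumrB.
  by under eq_bigr do rewrite -scalerBl.
have eq0 := cocenter_indep HT us (fun k => (mP _ (nf_conj_class k)).1) rel.
apply/funext => O; have [/conj_classesP[k ->]|nO] := pselect (conj_classes O); last first.
  by rewrite f0 // g0.
have [ks|ks] := boolP (k \in s); first by apply/eqP; rewrite -subr_eq0 eq0.
have -> : f (nf_class k) = 0 by apply/eqP; apply: contraNT ks; apply: fs.
by apply/esym/eqP; apply: contraNT ks; apply: gs.
Qed.

Lemma coef_of_class_coefs w e : uniq [seq p.2 | p <- e] ->
  expands T (T w) e -> class_coefs T w (coef_of e).
Proof.
move=> ue he; split.
- move=> O nO; rewrite /coef_of big1 // => p /asboolP eO.
  by case: nO; rewrite eO; apply: nf_conj_class.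
- apply: (@sub_finite_set _ _ [set` [seq nf_class p.2 | p <- e]]); last exact: finite_seq.
  move=> O /= hO; apply: contraNT hO => Oe; rewrite /coef_of big_seq_cond big1 //.
  by move=> p /andP[pe /asboolP eO]; case/negP: Oe; apply/mapP; exists p.
- move=> m mP; apply: comm_equiv_trans (he m mP) _; apply: comm_equiv_eq.
  rewrite (@fsum_seq _ _ _ [seq nf_class p.2 | p <- e]).
  + rewrite big_map; apply: eq_big_seq => -[a k] ke.
    by rewrite (coef_of_in ue ke).
  + by rewrite (map_comp nf_class snd) map_inj_uniq //; apply: nf_class_inj.
  + by move=> O /mapP[p _ ->]; apply: nf_conj_class.
  + move=> O /conj_classesP[k ->] ke; rewrite coef_of_notin ?scale0r //.
    by apply: contra ke => /mapP[p pe ->]; apply/mapP; exists p.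
Qed.

Lemma class_polyE w e : uniq [seq p.2 | p <- e] -> expands T (T w) e ->
  class_poly T w = coef_of e.
Proof.
move=> ue he; have ce := coef_of_class_coefs ue he.
by apply: xget_unique => // g cg; apply: class_coefs_uniq cg ce.
Qed.

End ClassPolynomials.

(** * Identification of the terms with the classes in the statement *)

(** The n-th block contributes the reflection indices 2n, 2n - 1 and -n, so the first n blocks fill
    the intervals from 1 to 2n and from -n to -1. *)
Lemma cox_terms_mem n (p : laurent * nf) : p \in cox_terms n <->
  [\/ p = (1, nf_cox),
      exists i : nat, (0 < i <= n.*2)%N /\ p = (xi, nf_refl i%:Z),
      exists i : nat, (0 < i <= n)%N /\ p = (xi, nf_refl (- i%:Z)) |
      exists x j : nat, [/\ (0 < x <= n)%N, (x < j.*2)%N, (j < x.*2)%N &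
        p = (xi ^+ 2, nf_transl x j)]].
Proof.
elim: n p => [|n IH] p.
  rewrite inE; split=> [/eqP->|]; first exact: Or41.
  case=> [->//|[i [h]]|[i [h]]|[x [j [h]]]]; exfalso; lia.
rewrite [cox_terms _]/= -/(cox_terms n) !inE mem_cat; split.
  case/or4P=> [/eqP->|/eqP->|/eqP->|/orP[/mapP[j]|/IH]].
  - by apply: Or42; exists n.+1.*2; split; [lia | congr (_, nf_refl _); lia].
  - by apply: Or42; exists n.*2.+1; split; [lia | congr (_, nf_refl _); lia].
  - by apply: Or43; exists n.+1; split=> //; lia.
  - rewrite mem_index_iota => hj ->; apply: Or44; exists n.+1, j; split=> //; lia.
  - case=> [->|[i [h ->]]|[i [h ->]]|[x [j [h1 h2 h3 ->]]]].
    + exact: Or41.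
    + by apply: Or42; exists i; split=> //; lia.
    + by apply: Or43; exists i; split=> //; lia.
    + by apply: Or44; exists x, j; split=> //; lia.
have old : p \in cox_terms n -> [|| p == (xi, nf_refl (2 * n.+1)),
    p == (xi, nf_refl (2 * n.+1%:Z - 1)), p == (xi, nf_refl (- n.+1%:Z)) |
    (p \in [seq (xi ^+ 2, nf_transl n.+1 j) | j <- index_iota (uphalf n).+1 n.+1.*2])
    || (p \in cox_terms n)].
  by move=> ->; rewrite !orbT.
case=> [e|[i [h e]]|[i [h e]]|[x [j [h1 h2 h3 e]]]].
- by apply: old; apply/IH; apply: Or41.
- have [ei|[ei|le]] : i = n.+1.*2 \/ i = n.*2.+1 \/ (i <= n.*2)%N by lia.
  + by apply/or4P/Or41/eqP; rewrite e; congr (_, nf_refl _); lia.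
  + by apply/or4P/Or42/eqP; rewrite e; congr (_, nf_refl _); lia.
  + by apply: old; apply/IH; apply: Or42; exists i; split=> //; lia.
- have [ei|le] : i = n.+1 \/ (i <= n)%N by lia.
    by apply/or4P/Or43/eqP; rewrite e ei.
  by apply: old; apply/IH; apply: Or43; exists i; split=> //; lia.
- have [ex|le] : x = n.+1 \/ (x <= n)%N by lia.
    apply/or4P/Or44; apply/orP; left; rewrite e ex; apply: map_f.
    by rewrite mem_index_iota; lia.
  by apply: old; apply/IH; apply: Or44; exists x, j; split=> //; lia.
Qed.

Lemma nf_transl_inj x j x' j' : (x < j.*2)%N -> (j < x.*2)%N ->
  (x' < j'.*2)%N -> (j' < x'.*2)%N ->
  nf_transl x j = nf_transl x' j' -> x = x' /\ j = j'.
Proof. by rewrite /nf_transl => ? ? ? ? [] *; lia. Qed.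

(** Needed to read off coefficients without adding repeated terms. Translations from different
    blocks differ in the coefficient of alpha1. *)
Lemma cox_terms_uniq n : uniq [seq p.2 | p <- cox_terms n].
Proof.
elim: n => [//|n IH].
have new k : k \in [seq p.2 | p <- cox_terms n] ->
    [\/ k = nf_cox, exists i : nat, (0 < i <= n.*2)%N /\ k = nf_refl i%:Z,
      exists i : nat, (0 < i <= n)%N /\ k = nf_refl (- i%:Z) |
      exists x j : nat, [/\ (0 < x <= n)%N, (x < j.*2)%N, (j < x.*2)%N &
        k = nf_transl x j]].
  case/mapP=> p /cox_terms_mem[->|[i [h ->]]|[i [h ->]]|[x [j [h1 h2 h3 ->]]]] ->.
  - exact: Or41.
  - by apply: Or42; exists i.
  - by apply: Or43; exists i.
  - by apply: Or44; exists x, j.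
rewrite [cox_terms _]/= -/(cox_terms n) /= map_cat.
set tr := [seq p.2 | p <- [seq _ | _ <- _]].
have trP k : k \in tr -> exists j : nat,
    [/\ (n.+1 < j.*2)%N, (j < n.+1.*2)%N & k = nf_transl n.+1 j].
  by case/mapP=> p /mapP[j]; rewrite mem_index_iota => hj -> ->; exists j; split=> //; lia.
have refl_new i : (i = 2 * n.+1%:Z \/ i = 2 * n.+1%:Z - 1 \/ i = - n.+1%:Z) ->
    nf_refl i \notin tr ++ [seq p.2 | p <- cox_terms n].
  move=> hi; rewrite mem_cat negb_or; apply/andP; split.
    by apply/negP => /trP[j [_ _]].
  apply/negP => /new[//|[i' [h [e]]]|[i' [h [e]]]|[x [j [_ _ _]]]//]; lia.
rewrite !inE !negb_or !refl_new; try by [left | right; left | right; right].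
have R i i' : i != i' -> nf_refl i != nf_refl i' by apply: contra => /eqP[e]; lia.
rewrite !R //=; try lia.
rewrite cat_uniq IH andbT; apply/andP; split.
  rewrite /tr -map_comp map_inj_in_uniq ?iota_uniq // => j j'.
  rewrite !mem_index_iota => h h' /= e.
  by have [] := @nf_transl_inj n.+1 j n.+1 j' _ _ _ _ e; lia.
apply/hasPn => k /new hk; apply/negP => /trP[j [h h' ek]].
case: hk => [|[i [_]]|[i [_]]|[x [j' [h1 h2 h3]]]]; rewrite ek //.
by case/(nf_transl_inj h h' h2 h3) => e _; lia.
Qed.

Lemma class_length_min (X : set extW) x : min_length_in X x ->
  class_length X = ell x.
Proof.
move=> [Xx xmin]; apply: set_minP; first by exists x; rewrite ?lengthE.
by move=> m [y Xy <-]; rewrite -lengthE; apply: xmin.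
Qed.

Lemma class_length_refl i : i != 0 -> class_length (refl_class i) = refl_len i.
Proof.
move=> i0; rewrite (@class_length_min _ (refl_min i)) ?ell_refl_min //.
split=> [|y yc]; first by exists ((i + 2) %/ 2)%Z; apply: Or31.
by rewrite !lengthE ell_refl_min //; apply: refl_len_le.
Qed.

Lemma refl_class_conj i x : refl_class i x -> conj_class x = refl_class i.
Proof. by rewrite refl_classE => /conj_class_eq <-. Qed.

(** The element t^b s1 with b = n alpha1 + 2n alpha2 lies in C_(2n), and [refl_len] is strictly
    increasing in |i|; so the bound on lengths is a bound on indices. Likewise t^b s2 lies in
    C'_n. *)
Lemma C_leP n X : (0 < n)%N -> C_le (root_comb n%:Z (2 * n%:Z)) X <->
  exists i : nat, (0 < i <= n.*2)%N /\ X = nf_class (nf_refl i%:Z).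
Proof.
move=> n0; have len i : (0 < i)%N -> (class_length (C_ i) <= class_length
    (conj_class (transl (root_comb n%:Z (2 * n%:Z)) * s1)%g))%N = (i <= n.*2)%N.
  move=> i0; rewrite C_E -refl_classE root_combE s1_mk transl_mk mkM.
  rewrite (@refl_class_conj (2 * n%:Z)); last first.
    by exists n%:Z; apply: Or31; congr mk => /=; lia.
  rewrite !class_length_refl; try lia.
  by rewrite /refl_len; case: ifP => h; case: ifP => h'; lia.
split=> [[i [i0 le] <-]|[i [/andP[i0 le] ->]]]; exists i; rewrite ?C_E //.
  by rewrite len // in le; rewrite i0 le.
by split=> //; rewrite len.
Qed.

Lemma C'_leP n X : (0 < n)%N -> C'_le (root_comb n%:Z (2 * n%:Z)) X <->
  exists i : nat, (0 < i <= n)%N /\ X = nf_class (nf_refl (- i%:Z)).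
Proof.
move=> n0; have len i : (0 < i)%N -> (class_length (C'_ i) <= class_length
    (conj_class (transl (root_comb n%:Z (2 * n%:Z)) * s2)%g))%N = (i <= n)%N.
  move=> i0; rewrite C'_E -mulrN -refl_classE root_combE s2_mk transl_mk mkM.
  rewrite (@refl_class_conj (- n%:Z)); last first.
    by exists (2 * n%:Z); apply: Or32; congr mk => /=; lia.
  rewrite !class_length_refl; try lia.
  by rewrite /refl_len; case: ifP => h; case: ifP => h'; lia.
split=> [[i [i0 le] <-]|[i [/andP[i0 le] ->]]]; exists i;
  rewrite ?C'_E /nf_refl ?mulrN //.
  by rewrite len // in le; rewrite i0 le.
by split=> //; rewrite len.
Qed.

(** Among dominant coweights, [Q_sh] removes exactly the walls, so the dominance inequalities become
    strict. They force j < 2x <= 2n, so the bound on j and the strictness of the root order follow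
    from x <= n. *)
Lemma Q_belowP n mu : Q_below (root_comb n%:Z (2 * n%:Z)) mu <->
  exists x j : nat, [/\ (0 < x <= n)%N, (x < j.*2)%N, (j < x.*2)%N &
    mu = root_comb x%:Z j%:Z].
Proof.
split.
  case=> -[[a [b ->]] [dom [p [q [pq lt]]]]] [_ sh].
  move: dom lt; rewrite /dominant !root_combE /= => /andP[d1 d2] [e1 e2].
  have ne k : b = 2 * k -> a = k -> False.
    by move=> eb ea; apply: sh; exists k; left; rewrite eb ea.
  have ne' k : b = k -> a = 2 * k -> False.
    by move=> eb ea; apply: sh; exists k; right; left; rewrite eb ea.
  have h1 := ne a; have h2 := ne' b.
  exists (absz a), (absz b); rewrite -root_combE.
  by split; [| | | congr root_comb]; lia.
case=> x [j [h1 h2 h3 ->]]; split.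
  split; first by exists x%:Z, j%:Z.
  split; first by rewrite /dominant root_combE /=; lia.
  exists (n - x)%N, (2 * n - j)%N; split; first by case; lia.
  by rewrite !root_combE; congr pair => /=; lia.
split; first by exists x%:Z, j%:Z.
by case=> k; rewrite !root_combE => -[[]|[[]|[]]]; lia.
Qed.

Lemma O_transl_root_comb (x j : nat) : (x < j.*2)%N -> (j < x.*2)%N ->
  O_transl (root_comb x%:Z j%:Z) = nf_class (nf_transl x j).
Proof.
move=> xj jx; rewrite root_combE -O_translE; congr (O_transl (_, _)); lia.
Qed.

Lemma T_cox_conj (H : algType laurent) (T : extW -> H) (HT : Hecke_basis T) n :
  comm_equiv (T (mk 1 (3 * n%:Z + 1) Wba)) (T (cox n)).
Proof.
have e1 : (s0 * cox n * s0)%g = mk (- (3 * n%:Z + 1)) 2 Wba.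
  by rewrite s0_mk !mkM; congr mk => /=; lia.
have h1 : comm_equiv (T (mk (- (3 * n%:Z + 1)) 2 Wba)) (T (cox n)).
  rewrite -e1; apply: (T_conj_eq HT s0_simple).
  by rewrite e1 !ell_mk /ellz /=; lia.
have h2 := comm_equiv_trans (T_conj_tau HT _) h1.
have := comm_equiv_trans (T_conj_tau HT _) h2.
rewrite !tau_mk !mk_conj /=; congr (comm_equiv (T (mk _ _ _)) _); lia.
Qed.

(** Conjugate by s0, which lengthens [cox n] from the right, and then twice by tau, which has length
    0. *)
Lemma strong_conj_cox n : strong_conj (cox n) (mk 1 (3 * n%:Z + 1) Wba).
Proof.
have e1 : (s0 * cox n * s0^-1)%g = mk (- (3 * n%:Z + 1)) 2 Wba.
  by rewrite s0_mk mk_conj; congr mk => /=; lia.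
have e2 : (tau * mk (- (3 * n%:Z + 1)) 2 Wba * tau^-1)%g =
    mk (3 * n%:Z) (- (3 * n%:Z)) Wba.
  by rewrite tau_mk mk_conj; congr mk => /=; lia.
have e3 : (tau * mk (3 * n%:Z) (- (3 * n%:Z)) Wba * tau^-1)%g =
    mk 1 (3 * n%:Z + 1) Wba.
  by rewrite tau_mk mk_conj; congr mk => /=; lia.
have tauS a b a' b' : (tau * mk a b Wba * tau^-1)%g = mk a' b' Wba ->
    ellz a b Wba = ellz a' b' Wba -> elem_strong_conj (mk a b Wba) (mk a' b' Wba).
  move=> e el; split; first by rewrite !lengthE !ell_mk.
  exists tau; split=> //; left.
  by rewrite !lengthE ell_tauM tau_mk [ell (mk 1 0 Wab)]ell_mk.
have S1 : elem_strong_conj (cox n) (mk (- (3 * n%:Z + 1)) 2 Wba).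
  split; first by rewrite !lengthE !ell_mk /ellz /=; lia.
  exists s0; split=> //; right.
  by rewrite (simpleV s0_simple) !lengthE s0_mk !mkM !ell_mk /ellz /=; lia.
apply: (Relation_Operators.rt_trans _ _ _ _ _ (Relation_Operators.rt_step _ _ _ _ S1)).
apply: (Relation_Operators.rt_trans _ _ _ (mk (3 * n%:Z) (- (3 * n%:Z)) Wba));
  apply: Relation_Operators.rt_step; apply: tauS => //; rewrite /ellz /=; lia.
Qed.

Theorem proposition2p10 (H : algType laurent) (T : extW -> H)
    (HT : Hecke_basis T) (k : nat) (k_gt0 : (0 < k)%N) :
  let l := root_comb k%:Z (2 * k%:Z - 1) in
  let w12 := (transl l * s1 * s2)%g in
  let w21 := (transl l * s2 * s1)%g in
  let b := root_comb (k%:Z - 1) (2 * (k%:Z - 1)) in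
  [/\ strong_conj w12 w21,
      comm_equiv (T w12) (T w21) &
      forall w : extW, w = w12 \/ w = w21 ->
        (k = 1%N ->
          [/\ min_length_in O_2 w,
              class_poly T w O_2 = 1 &
              forall O, conj_classes O -> O <> O_2 -> class_poly T w O = 0]) /\
        ((2 <= k)%N ->
          [/\ forall mu, Q_below b mu ->
                class_poly T w (O_transl mu) = (vgen - vinv) ^+ 2,
              forall O, (C_le b `|` C'_le b) O ->
                class_poly T w O = vgen - vinv,
              class_poly T w O_2 = 1 &
              forall O, conj_classes O ->
                ~ (exists2 mu, Q_below b mu & O = O_transl mu) ->
                ~ (C_le b `|` C'_le b) O -> O <> O_2 ->
                class_poly T w O = 0])].
Proof.
(* With k = n + 1, the number n of blocks is also the coefficient k - 1 in b. *)
case: k k_gt0 => // n _ l w12 w21 b.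
have ew12 : w12 = cox n.
  by rewrite /w12 /l root_combE transl_mk s1_mk s2_mk !mkM; congr mk => /=; lia.
have ew21 : w21 = mk 1 (3 * n%:Z + 1) Wba.
  by rewrite /w21 /l root_combE transl_mk s1_mk s2_mk !mkM; congr mk => /=; lia.
have eb : b = root_comb n%:Z (2 * n%:Z) by rewrite /b; congr root_comb; lia.
rewrite ew12 ew21 eb; split.
- exact: strong_conj_cox.
- exact: comm_equiv_sym (T_cox_conj HT n).
move=> w hw.
have Tw : comm_equiv (T w) (T (cox n)).
  by case: hw => ->; [apply: comm_equiv_refl | apply: T_cox_conj].
have u := cox_terms_uniq n.
have fE := class_polyE HT u (expands_trans Tw (expands_cox HT n)).
have f_in p : p \in cox_terms n -> class_poly T w (nf_class p.2) = p.1.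
  by rewrite fE; case: p => a k; apply: coef_of_in.
have f_notin O : conj_classes O ->
    (forall p, p \in cox_terms n -> O <> nf_class p.2) -> class_poly T w O = 0.
  move=> /conj_classesP[k ->] kn; rewrite fE; apply: coef_of_notin.
  by apply/mapP => -[p pn kp]; apply: (kn p pn); rewrite kp.
have f1 : class_poly T w O_2 = 1.
  by rewrite O_2E (f_in (1, nf_cox)) //; apply/cox_terms_mem; apply: Or41.
split=> [[n0]|n2].
  (* For n = 0 the expansion consists of the single term of O_2. *)
  rewrite n0 in f_notin hw *; split=> //.
    split.
      by case: hw => ->; rewrite O_2E; [apply: (@conj_class_mk 0 1 We) |
        apply: (@conj_class_mk 1 0 Wa)].
    have -> : length w = 2 by case: hw => ->; rewrite lengthE ell_mk.
    move=> x [[a c] /root_latticeP[e ace]]; rewrite s1_mk s2_mk transl_mk !mkM /=.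
    by case=> ->; rewrite lengthE ell_mk /ellz /=; lia.
  move=> O cO OO2; apply: f_notin => // p; rewrite inE => /eqP-> /= Oe.
  by apply: OO2; rewrite O_2E.
split=> //.
- move=> mu /Q_belowP[x [j [h1 h2 h3 ->]]]; rewrite O_transl_root_comb //.
  rewrite (f_in (xi ^+ 2, nf_transl x j)) //; apply/cox_terms_mem/Or44.
  by exists x, j.
- move=> O [/C_leP-/(_ n2)|/C'_leP-/(_ n2)] [i [hi ->]].
    by rewrite (f_in (xi, nf_refl i)) //; apply/cox_terms_mem/Or42; exists i.
  by rewrite (f_in (xi, nf_refl (- i%:Z))) //; apply/cox_terms_mem/Or43; exists i.
- move=> O cO nt nC nO; apply: f_notin => // p /cox_terms_mem.
  case=> [->|[i [hi ->]]|[i [hi ->]]|[x [j [h1 h2 h3 ->]]]] /= Oe.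
  + by apply: nO; rewrite O_2E.
  + by apply: nC; left; apply/C_leP => //; exists i.
  + by apply: nC; right; apply/C'_leP => //; exists i.
  + apply: nt; exists (root_comb x%:Z j%:Z); last by rewrite O_transl_root_comb.
    by apply/Q_belowP; exists x, j.
Qed.
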